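(* Let $m_1,m_2\in\mathbb{N}$ with $m_1$ odd and $m_2/2$ an even natural number, and let $\mathcal{O}(u)=-y^{m_1}u_{xx}-x^{m_2}u_{yy}$. Let $\Omega\subset\mathbb{R}^2$ be a Tricomi domain for $\mathcal{O}$, with boundary $\partial\Omega=\sigma\cup AC\cup BC$, which is admissible for the operator $\mathcal{O}$. Then for every $f\in L^2(\Omega)$ there exists a unique weak solution $u\in W^1_{AC\cup\sigma}$ of the problem $$\begin{cases}\mathcal{O}(u)=f(x,y) & \text{in } \Omega,\\ u=0 & \text{on } AC\cup\sigma\subseteq\partial\Omega.\end{cases}$$ Moreover, the solution operator $$S_{AC\cup\sigma}:L^2(\Omega)\to W^1_{AC\cup\sigma},$$ which assigns to $f\in L^2(\Omega)$ the unique weak solution $u\in W^1_{AC\cup\sigma}$ of this problem, is linear and continuous.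
   Context: Tricomi domain. Let $m_1$ be odd and $m_2/2$ even (so $(m_2+2)/2$ is odd). Fix $0<x_0<x_1$ and put $A=(-x_1,0)$, $B=(x_0,0)$. A Tricomi domain for $\mathcal{O}=-y^{m_1}\partial_{xx}-x^{m_2}\partial_{yy}$ is an open, bounded, simply connected set $\Omega\subset\mathbb{R}^2$ with piecewise $C^1$ boundary $\partial\Omega=\sigma\cup AC\cup BC$, where $\sigma$ is a piecewise $C^2$ simple arc joining $A$ and $B$ and lying (apart from its endpoints) in $\{y>0\}$, and $AC$, $BC$ are the characteristic curves of $\mathcal{O}$ in $\{-x_1\le x\le x_0,\ y\le 0\}$ passing through $A$ and $B$ respectively and meeting at the point $C=(x_c,y_c)$: $$AC=\Big\{(x,y): y_c\le y\le 0,\ \tfrac{2}{m_1+2}(-y)^{\frac{m_1+2}{2}}=\tfrac{2}{m_2+2}\big[x^{\frac{m_2+2}{2}}+x_1^{\frac{m_2+2}{2}}\big]\Big\},$$ $$BC=\Big\{(x,y): y_c\le y\le 0,\ \tfrac{2}{m_1+2}(-y)^{\frac{m_1+2}{2}}=-\tfrac{2}{m_2+2}\big[x^{\frac{m_2+2}{2}}-x_0^{\frac{m_2+2}{2}}\big]\Big\},$$ with $$x_c=-\Big[\tfrac12\big(x_1^{\frac{m_2+2}{2}}-x_0^{\frac{m_2+2}{2}}\big)\Big]^{\frac{2}{m_2+2}},\qquad y_c=-\Big[\tfrac12\,\tfrac{m_1+2}{m_2+2}\big(x_1^{\frac{m_2+2}{2}}+x_0^{\frac{m_2+2}{2}}\big)\Big]^{\frac{2}{m_1+2}}.$$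 Function spaces. For $\Gamma\in\{AC\cup\sigma,\ BC\cup\sigma\}$ let $C^\infty_{\Gamma}(\overline\Omega)=\{u\in C^\infty(\overline\Omega): u|_{\Gamma}=0\}$, and let $W^1_{\Gamma}$ be the closure (completion) of $C^\infty_{\Gamma}(\overline\Omega)$ in the weighted norm $$\|u\|_{W^1_\Gamma}^2=\int_\Omega\big(|y|^{m_1}u_x^2+|x|^{m_2}u_y^2+u^2\big)\,dx\,dy .$$ Let $W^{-1}_{\Gamma}$ be the dual space of $W^1_\Gamma$, with the negative norm $$\|\varphi\|_{W^{-1}_\Gamma}=\sup_{0\ne u\in W^1_\Gamma}\frac{|(\varphi,u)_{L^2}|}{\|u\|_{W^1_\Gamma}},$$ where $(\cdot,\cdot)_{L^2}$ denotes the $L^2(\Omega)$ inner product extended to the duality pairing; thus $W^1_\Gamma\subset L^2(\Omega)\subset W^{-1}_\Gamma$. Extensions of $\mathcal{O}$. $\mathcal{O}_{AC}:W^1_{AC\cup\sigma}\to W^{-1}_{BC\cup\sigma}$ and $\mathcal{O}_{BC}:W^1_{BC\cup\sigma}\to W^{-1}_{AC\cup\sigma}$ denote the unique continuous extensions of $\mathcal{O}$ from the dense subspaces $C^\infty_{AC\cup\sigma}(\overline\Omega)$ and $C^\infty_{BC\cup\sigma}(\overline\Omega)$ respectively; they satisfy $(\mathcal{O}_{AC}u,v)_{L^2}=\int_\Omega(y^{m_1}u_xv_x+x^{m_2}u_yv_y)\,dx\,dy=(u,\mathcal{O}_{BC}v)_{L^2}$ for $u\in W^1_{AC\cup\sigma}$,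 $v\in W^1_{BC\cup\sigma}$. Admissibility. A Tricomi domain $\Omega$ is admissible for $\mathcal{O}$ if there are positive constants $C_3,C_4$ such that $$\|u\|_{L^2(\Omega)}\le C_3\|\mathcal{O}_{AC}u\|_{W^{-1}_{BC\cup\sigma}}\ \ \forall u\in W^1_{AC\cup\sigma},\qquad \|v\|_{L^2(\Omega)}\le C_4\|\mathcal{O}_{BC}v\|_{W^{-1}_{AC\cup\sigma}}\ \ \forall v\in W^1_{BC\cup\sigma}.$$ Weak solution. Given $f\in L^2(\Omega)$, $u\in W^1_{AC\cup\sigma}$ is a weak solution of the problem $\mathcal{O}(u)=f$ in $\Omega$, $u=0$ on $AC\cup\sigma$, if $$\int_\Omega\big(y^{m_1}u_xv_x+x^{m_2}u_yv_y\big)\,dx\,dy=\int_\Omega fv\,dx\,dy\qquad\text{for all } v\in C^\infty_{BC\cup\sigma}(\overline\Omega).$$ *)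

(* Defs.v *)
From HB Require Import structures.
From mathcomp Require Import all_boot all_order all_algebra.
From mathcomp Require Import all_classical all_reals all_analysis.

Set Implicit Arguments.
Unset Strict Implicit.
Unset Printing Implicit Defensive.

Import Order.TTheory GRing.Theory Num.Theory.
Import numFieldNormedType.Exports.

Local Open Scope classical_set_scope.
Local Open Scope ring_scope.

Section Curves.
Context {R : realType}.
Implicit Types (g c : R -> R * R) (k : nat).

Definition class_C k g : Prop :=
  (forall i, (i < k)%N -> forall t : R, derivable (derive1n i g) t 1) /\
  continuous (derive1n k g).

(* Regular piecewise C^k curves on [0, 1]: on each closed piece of a partition
   the curve is the restriction of a C^k curve with nonzero velocity. *)
Definition piecewise_C k c : Prop :=
  exists s : seq R,
    [/\ sorted <%R (0 :: s), last 0 s = 1 &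
      forall i, (i < size s)%N -> exists g, class_C k g /\
        forall t, nth 0 (0 :: s) i <= t <= nth 0 s i ->
          c t = g t /\ derive1 g t != 0].

Definition simply_connected (D : set (R * R)) : Prop :=
  (forall p q, D p -> D q -> exists c,
     [/\ {within `[0, 1], continuous c}, c 0 = p, c 1 = q &
         forall t, 0 <= t <= 1 -> D (c t)]) /\
  (forall c, {within `[0, 1], continuous c} -> c 0 = c 1 ->
     (forall t, 0 <= t <= 1 -> D (c t)) ->
     exists (H : R * R -> R * R) (p : R * R),
       [/\ {within `[0, 1] `*` `[0, 1], continuous H},
           forall t s, 0 <= t <= 1 -> 0 <= s <= 1 -> D (H (t, s)),
           forall t, 0 <= t <= 1 -> H (t, 0) = c t,
           forall t, 0 <= t <= 1 -> H (t, 1) = p &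
           forall s, 0 <= s <= 1 -> H (0, s) = H (1, s)]).

End Curves.

Section TricomiDomain.
Context {R : realType}.
Variables (m1 m2 : nat) (x0 x1 : R).

Let a1 : R := (m1 + 2)%:R / 2.
Let k2 : nat := (m2 + 2)./2.

Definition char_yc : R :=
  - (2^-1 * ((m1 + 2)%:R / (m2 + 2)%:R) * (x1 ^+ k2 + x0 ^+ k2)) `^
    (2 / (m1 + 2)%:R).

Definition char_xc : R :=
  - (2^-1 * (x1 ^+ k2 - x0 ^+ k2)) `^ (2 / (m2 + 2)%:R).

(* The power of -y has a half-integer exponent and a nonnegative base; the
   power of x has the natural exponent (m2 + 2)/2, x being of either sign. *)
Definition char_AC : set (R * R) := [set p | char_yc <= p.2 <= 0 /\
  2 / (m1 + 2)%:R * (- p.2) `^ a1 =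
  2 / (m2 + 2)%:R * (p.1 ^+ k2 + x1 ^+ k2)].

Definition char_BC : set (R * R) := [set p | char_yc <= p.2 <= 0 /\
  2 / (m1 + 2)%:R * (- p.2) `^ a1 =
  - (2 / (m2 + 2)%:R * (p.1 ^+ k2 - x0 ^+ k2))].

Record tricomi_domain (sigma Omega : set (R * R)) : Prop := TricomiDomain {
  tricomi_open : open Omega;
  tricomi_bounded : bounded_set Omega;
  tricomi_simply_connected : simply_connected Omega;
  tricomi_boundary :
    closure Omega `\` Omega = sigma `|` char_AC `|` char_BC;
  tricomi_boundary_C1 : exists c : R -> R * R,
    [/\ piecewise_C 1 c, {in `[0, 1[ &, injective c}, c 0 = c 1 &
        closure Omega `\` Omega = c @` `[0, 1]];
  tricomi_sigma : exists c : R -> R * R,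
    [/\ piecewise_C 2 c, {in `[0, 1] &, injective c},
        sigma = c @` `[0, 1],
        c 0 = (- x1, 0) /\ c 1 = (x0, 0) &
        forall t, 0 < t < 1 -> 0 < (c t).2];
  tricomi_meet : char_AC `&` char_BC = [set (char_xc, char_yc)]
}.

End TricomiDomain.

(* Continuity on the subset D for the topologies given by two seminorms. *)
Definition seminorm_continuous {R : realType} {E F : zmodType}
    (D : E -> Prop) (NE : E -> \bar R) (NF : F -> \bar R) (T : E -> F) : Prop :=
  forall u, D u -> forall e : R, 0 < e -> exists2 d : R, 0 < d &
    forall v, D v -> (NE (v - u)%R < d%:E)%E -> (NF (T v - T u)%R < e%:E)%E.

Section Spaces.
Context {R : realType}.
Variables (m1 m2 : nat) (Omega : set (R * R)).

Local Notation mu2 := (@lebesgue_measure R \x @lebesgue_measure R)%E.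

(* Elements of L^2(Omega) are handled through representatives defined on the
   whole plane; only their values on Omega matter, up to null sets. *)
Definition L2 (f : R * R -> R) : Prop := f \_ Omega \in Lfun mu2 2%:E.

Definition L2norm (f : R * R -> R) : \bar R :=
  ('N[mu2]_2%:E [EFin \o (f \_ Omega)])%E.

Definition L2dot (f g : R * R -> R) : R :=
  \int[mu2]_(z in Omega) (f z * g z).

Definition ex : R * R := (1, 0).
Definition ey : R * R := (0, 1).

Definition partial (s : seq bool) (u : R * R -> R) : R * R -> R :=
  foldr (fun b g z => 'D_(if b then ex else ey) g z) u s.

(* C^oo of the closed domain: partial derivatives of all orders exist in Omega
   and extend continuously to its closure; the values of u on the boundary are
   those of the continuous extension. *)
Definition smooth_closure (u : R * R -> R) : Prop :=
  {within closure Omega, continuous u} /\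
  forall s : seq bool,
    (forall z, Omega z -> derivable (partial s u) z ex /\
                          derivable (partial s u) z ey) /\
    exists g : R * R -> R, {within closure Omega, continuous g} /\
      forall z, Omega z -> g z = partial s u z.

Definition smooth_vanishing (G : set (R * R)) (u : R * R -> R) : Prop :=
  smooth_closure u /\ forall z, G z -> u z = 0.

Definition op_O (u : R * R -> R) (z : R * R) : R :=
  - z.2 ^+ m1 * partial [:: true; true] u z
  - z.1 ^+ m2 * partial [:: false; false] u z.

(* The completion W^1_G is realized as the closure of the 1-jets
   (u, u_x, u_y), u smooth and vanishing on G, in the weighted L^2 space of
   triples ((u, p), q) with squared norm
     \int_Omega |y|^m1 p^2 + |x|^m2 q^2 + u^2.
   Its elements are triples modulo those of zero norm. *)
Definition jet : Type :=
  ((R * R -> R) * (R * R -> R) * (R * R -> R))%type.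

Definition val0 (w : jet) : R * R -> R := w.1.1.
Definition valx (w : jet) : R * R -> R := w.1.2.
Definition valy (w : jet) : R * R -> R := w.2.

Definition jet_of (u : R * R -> R) : jet :=
  ((u, partial [:: true] u), partial [:: false] u).

Definition W1norm (w : jet) : \bar R :=
  ((\int[mu2]_(z in Omega)
      (`|z.2| ^+ m1 * valx w z ^+ 2 + `|z.1| ^+ m2 * valy w z ^+ 2
       + val0 w z ^+ 2)%R%:E) `^ 2^-1)%E.

Definition W1 (G : set (R * R)) (w : jet) : Prop :=
  [/\ measurable_fun Omega (val0 w), measurable_fun Omega (valx w),
      measurable_fun Omega (valy w) &
      exists phi : nat -> R * R -> R,
        (forall n, smooth_vanishing G (phi n)) /\
        W1norm (w - jet_of (phi n)) @[n --> \oo] --> 0%E].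

Definition W1dual (G : set (R * R)) (F : jet -> R) : Prop :=
  (forall (a : R) v w, W1 G v -> W1 G w -> F (a *: v + w) = a * F v + F w) /\
  exists C : R, forall w, W1 G w -> (`|F w|%:E <= C%:E * W1norm w)%E.

Definition W1dual_norm (G : set (R * R)) (F : jet -> R) : \bar R :=
  ereal_sup [set (`|F w| / fine (W1norm w))%:E |
             w in [set w | W1 G w /\ W1norm w != 0%E]].

Definition energy (u v : jet) : R :=
  \int[mu2]_(z in Omega)
    (z.2 ^+ m1 * valx u z * valx v z + z.1 ^+ m2 * valy u z * valy v z).

(* L extends op_O, from smooth functions vanishing on G, to a continuous linear
   operator from W^1_G to the dual of W^1_G'; a square-integrable function h
   acts on the dual side by the L^2 pairing with h. *)
Definition continuous_extension (G G' : set (R * R))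
    (L : jet -> jet -> R) : Prop :=
  [/\ forall u, W1 G u -> W1dual G' (L u),
      forall (a : R) u v w, W1 G u -> W1 G v -> W1 G' w ->
        L (a *: u + v) w = a * L u w + L v w,
      seminorm_continuous (W1 G) W1norm (W1dual_norm G') L &
      forall u, smooth_vanishing G u -> forall w, W1 G' w ->
        L (jet_of u) w = L2dot (op_O u) (val0 w)].

End Spaces.

Section Problem.
Context {R : realType}.
Variables (m1 m2 : nat) (x0 x1 : R) (sigma Omega : set (R * R)).

Definition gamma_AC : set (R * R) := char_AC m1 m2 x0 x1 `|` sigma.
Definition gamma_BC : set (R * R) := char_BC m1 m2 x0 x1 `|` sigma.

(* OAC and OBC are the continuous extensions of op_O, adjoint to each other
   through the energy form. *)
Definition extensions (OAC OBC : @jet R -> @jet R -> R) : Prop :=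
  [/\ continuous_extension m1 m2 Omega gamma_AC gamma_BC OAC,
      continuous_extension m1 m2 Omega gamma_BC gamma_AC OBC &
      forall u v, W1 m1 m2 Omega gamma_AC u -> W1 m1 m2 Omega gamma_BC v ->
        OAC u v = energy m1 m2 Omega u v /\
        OBC v u = energy m1 m2 Omega u v].

Definition admissible (OAC OBC : @jet R -> @jet R -> R) : Prop :=
  exists C3 C4 : R, [/\ 0 < C3, 0 < C4,
    forall u, W1 m1 m2 Omega gamma_AC u ->
      (L2norm Omega (val0 u) <=
       C3%:E * W1dual_norm m1 m2 Omega gamma_BC (OAC u))%E &
    forall v, W1 m1 m2 Omega gamma_BC v ->
      (L2norm Omega (val0 v) <=
       C4%:E * W1dual_norm m1 m2 Omega gamma_AC (OBC v))%E].

Definition weak_solution (f : R * R -> R) (u : @jet R) : Prop :=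
  W1 m1 m2 Omega gamma_AC u /\
  forall v, smooth_vanishing Omega gamma_BC v ->
    energy m1 m2 Omega u (jet_of v) = L2dot Omega f v.

(* Equality in W^1. *)
Definition W1eq (u v : @jet R) : Prop := W1norm m1 m2 Omega (u - v) = 0%E.

End Problem.

(* Main.v *)
Require Import Defs.
From HB Require Import structures.
From mathcomp Require Import all_boot all_order all_algebra.
From mathcomp Require Import all_classical all_reals all_analysis.
From mathcomp Require Import measurable_realfun ring lra.

Set Implicit Arguments.
Unset Strict Implicit.
Unset Printing Implicit Defensive.

Import Order.TTheory GRing.Theory Num.Theory.
Import numFieldNormedType.Exports.

Local Open Scope classical_set_scope.
Local Open Scope ring_scope.

(** The weak solution is obtained by Hilbert-space duality in the weighted space
of jets, and its uniqueness in the norm of that space by closability of the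
degenerate gradient.

Existence.  The energy form is bounded by the product of the weighted norms, so
every jet [v] vanishing on BC and sigma has a Riesz representative [e], vanishing
on AC and sigma, such that the inner product of [e] with [u] is the energy of
[u] and [v] ([energy_representation]).  The norm of [e] is the negative norm of
the adjoint operator applied to [v], so the admissibility inequality for the
adjoint says that the functional sending [e] to the pairing of [f] with [v] is
bounded by C4 times the norm of [f].  A second use of the Riesz theorem, now for
a functional defined on the set of such [e] only ([riesz_graph]), yields the
solution together with the bound of its norm by C4 times that of [f]
([weak_existence]).  The Riesz theorem needs completeness, which comes from the
Riesz-Fischer theorem for weighted square-integrable functions
([wL2_complete]).

Uniqueness.  The difference of two solutions is annihilated by the operator,
since smooth test functions are dense.  The admissibility inequality for the
operator itself then makes its value vanish almost everywhere.  The norm also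
involves the derivatives, which in a completion are independent components of a
jet; that they vanish as well is the closability of the gradient ([closable]).
Let smooth functions phi_n approximate the jet [w] whose value is zero, let p be
its x-derivative, and let s be a cutoff in the variable x that vanishes on two
opposite sides of a box inside the domain.  The weight rho = |y|^m1 does not
depend on x, hence integration by parts ([box_ibp]) gives

   int s rho (phi_n)_x (phi_m)_x = - int rho phi_n (s (phi_m)_x)_x,

where the right-hand side tends to zero as n grows, because phi_n tends to zero
in square mean.  Letting then m grow, the integral of s rho p^2 is zero.
Countably many boxes exhaust the domain, so the weighted derivative vanishes
almost everywhere.  The y-derivative is treated in the same way.

Linearity of the solution operator follows from uniqueness, and its continuity
from uniqueness and the bound on the solution. *)

(** * Semi-inner products and Riesz representation *)

(** Hilbert-space arguments are run on representatives, so the form is only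
positive semidefinite and is only controlled on a subspace [D]. *)
Record semi_inner (R : realType) (E : lmodType R) (D : E -> Prop)
    (dot : E -> E -> R) : Prop := SemiInner {
  semi_inner_dom0 : D 0;
  semi_inner_domP : forall (a : R) u v, D u -> D v -> D (a *: u + v);
  semi_innerC : forall u v, D u -> D v -> dot u v = dot v u;
  semi_innerPl : forall (a : R) u v w, D u -> D v -> D w ->
    dot (a *: u + v) w = a * dot u w + dot v w;
  semi_inner_ge0 : forall u, D u -> 0 <= dot u u }.

Definition semi_complete (R : realType) (E : lmodType R) (D : E -> Prop)
    (dot : E -> E -> R) : Prop :=
  forall x : nat -> E, (forall n, D (x n)) ->
    (forall e : R, 0 < e -> exists N, forall n m, (N <= n)%N -> (N <= m)%N ->
       dot (x n - x m) (x n - x m) < e) ->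
    exists2 y, D y & forall e : R, 0 < e -> exists N, forall n, (N <= n)%N ->
       dot (x n - y) (x n - y) < e.

Lemma eq0_sqr_small (R : realFieldType) (x K : R) :
  (forall e, 0 < e -> x ^+ 2 <= e * K) -> x = 0.
Proof.
move=> H; have K0 : 0 <= K by have := H 1 ltr01; have := sqr_ge0 x; lra.
apply/eqP; rewrite -sqrf_eq0 eq_le sqr_ge0 andbT.
apply/ler_addgt0Pr => e e0; rewrite add0r.
have K1 : 0 < K + 1 by lra.
apply: le_trans (H (e / (K + 1)) _) _; first by rewrite divr_gt0.
by rewrite mulrAC ler_pdivrMr// ler_wpM2l ?lerDl// ltW.
Qed.

(** The discriminant argument; enlarging [q] by one avoids discussing whether it
vanishes. *)
Lemma quadratic_bound (R : realFieldType) (x q e : R) : 0 <= q ->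
  (forall t, 0 <= t ^+ 2 * q + 2 * t * x + e) -> x ^+ 2 <= e * (q + 1).
Proof.
move=> q0 H; have q1 : 0 < q + 1 by lra.
have := H (- (x / (q + 1))).
set t := x / (q + 1); have -> : x = t * (q + 1) by rewrite /t; field; lra.
nra.
Qed.

Lemma sqr_split_le (R : realFieldType) (a b e x y : R) :
  (a + b) ^+ 2 <= e * x -> b ^+ 2 <= e * y ->
  a ^+ 2 <= e * (2 * x + 2 * y).
Proof. by move=> ? ?; have := sqr_ge0 (a + 2 * b); lra. Qed.

Section SemiInnerTheory.
Context {R : realType} {E : lmodType R} {D : E -> Prop} {dot : E -> E -> R}.
Hypothesis S : semi_inner D dot.

Lemma semi_inner_domZ (a : R) u : D u -> D (a *: u).
Proof.
by move=> Du; rewrite -[_ *: _]addr0; apply: (semi_inner_domP S) => //;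
  exact: (semi_inner_dom0 S).
Qed.

Lemma semi_inner_domD u v : D u -> D v -> D (u + v).
Proof. by move=> Du Dv; rewrite -[u]scale1r; exact: (semi_inner_domP S). Qed.

Lemma semi_inner_domB u v : D u -> D v -> D (u - v).
Proof.
by move=> Du Dv; rewrite addrC -scaleN1r; exact: (semi_inner_domP S).
Qed.

Lemma semi_inner_Pr (a : R) u v w : D u -> D v -> D w ->
  dot w (a *: u + v) = a * dot w u + dot w v.
Proof.
move=> Du Dv Dw; have Duv := semi_inner_domP S a Du Dv.
by rewrite (semi_innerC S)// (semi_innerPl S)// !(semi_innerC S _ Dw).
Qed.

Lemma semi_inner0l v : D v -> dot 0 v = 0.
Proof.
move=> Dv; have D0 := semi_inner_dom0 S.
by have := semi_innerPl S 1 D0 D0 Dv; rewrite scale1r addr0 mul1r; lra.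
Qed.

Lemma semi_innerBl u v w : D u -> D v -> D w ->
  dot (u - v) w = dot u w - dot v w.
Proof.
move=> Du Dv Dw; have := semi_innerPl S (-1) Dv Du Dw.
by rewrite scaleN1r addrC => ->; ring.
Qed.

Lemma semi_inner_sqr (a : R) u v : D u -> D v ->
  dot (a *: u + v) (a *: u + v) =
  a ^+ 2 * dot u u + 2 * a * dot u v + dot v v.
Proof.
move=> Du Dv; have Duv := semi_inner_domP S a Du Dv.
rewrite (semi_innerPl S)// !semi_inner_Pr// (semi_innerC S Dv Du); ring.
Qed.

Lemma semi_inner_sqrB u v : D u -> D v ->
  dot (u - v) (u - v) = dot u u - 2 * dot u v + dot v v.
Proof.
move=> Du Dv; rewrite addrC -scaleN1r semi_inner_sqr// (semi_innerC S Dv Du).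
ring.
Qed.

Lemma semi_inner_sqr_le (a : R) u v : D u -> D v ->
  dot (a *: u + v) (a *: u + v) <= 2 * a ^+ 2 * dot u u + 2 * dot v v.
Proof.
move=> Du Dv; rewrite semi_inner_sqr//.
have : 0 <= dot (a *: u - v) (a *: u - v).
  apply: (semi_inner_ge0 S); apply: semi_inner_domB => //.
  exact: semi_inner_domZ.
rewrite semi_inner_sqrB//; last exact: semi_inner_domZ.
have D0 := semi_inner_dom0 S.
have := semi_innerPl S a Du D0 Dv; rewrite addr0 semi_inner0l// addr0 => ->.
have := semi_inner_sqr a Du D0; rewrite addr0 => ->.
rewrite (semi_innerC S Du D0) !semi_inner0l//.
by move: (dot u u) (dot u v) (dot v v) => *; lra.
Qed.

Lemma cauchy_schwarz_sqr u v : D u -> D v ->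
  dot u v ^+ 2 <= dot u u * dot v v.
Proof.
move=> Du Dv; have q0 := semi_inner_ge0 S Du.
have p0 := semi_inner_ge0 S Dv.
have H t : 0 <= t ^+ 2 * dot u u + 2 * t * dot u v + dot v v.
  rewrite -semi_inner_sqr//; apply: (semi_inner_ge0 S).
  exact: (semi_inner_domP S).
have [q1|q1] := ltP 0 (dot u u); last first.
  have qE : dot u u = 0 by lra.
  rewrite qE mul0r; have [->|xn0] := eqVneq (dot u v) 0; first by rewrite expr0n.
  have := H (- ((dot v v + 1) / (2 * dot u v))).
  rewrite qE mulr0 add0r.
  have -> : 2 * - ((dot v v + 1) / (2 * dot u v)) * dot u v = - (dot v v + 1).
    by field.
  by move=> ?; exfalso; lra.
have := H (- (dot u v / dot u u)).
have -> : (- (dot u v / dot u u)) ^+ 2 * dot u u +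
   2 * - (dot u v / dot u u) * dot u v + dot v v =
   (dot u u * dot v v - dot u v ^+ 2) / dot u u by field; lra.
by rewrite pmulr_lge0 ?invr_gt0//; lra.
Qed.

Lemma cauchy_schwarz u v : D u -> D v ->
  `|dot u v| <= Num.sqrt (dot u u) * Num.sqrt (dot v v).
Proof.
move=> Du Dv; rewrite -sqrtrM ?(semi_inner_ge0 S)// -sqrtr_sqr.
by rewrite ler_sqrt ?cauchy_schwarz_sqr// mulr_ge0 ?(semi_inner_ge0 S).
Qed.

Lemma semi_inner_minkowski u v : D u -> D v ->
  Num.sqrt (dot (u + v) (u + v)) <= Num.sqrt (dot u u) + Num.sqrt (dot v v).
Proof.
move=> Du Dv; have u0 := semi_inner_ge0 S Du; have v0 := semi_inner_ge0 S Dv.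
have su := sqr_sqrtr u0; have sv := sqr_sqrtr v0.
have := cauchy_schwarz Du Dv; have su0 := sqrtr_ge0 (dot u u).
have sv0 := sqrtr_ge0 (dot v v).
move=> cs; have uv : dot u v <= Num.sqrt (dot u u) * Num.sqrt (dot v v).
  by apply: le_trans cs; exact: ler_norm.
have sq0 : 0 <= Num.sqrt (dot u u) + Num.sqrt (dot v v) by lra.
rewrite -(ger0_norm sq0) -sqrtr_sqr ler_sqrt ?sqr_ge0//.
by have := semi_inner_sqr 1 Du Dv; rewrite scale1r => ->; nra.
Qed.

(** Riesz representation of a bounded linear functional given by its graph [G].
Working with a graph rather than with a function lets the same statement serve
for functionals on the whole space and for functionals defined on the range of
an operator that is only determined up to vectors of zero norm.  The
representative is the limit of a minimizing sequence of
[dot e e - 2 r], which is Cauchy by the parallelogram identity. *)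
Lemma riesz_graph (C : R) (G : E -> R -> Prop) :
  semi_complete D dot -> 0 <= C -> G 0 0 ->
  (forall (a : R) e r e' r', G e r -> G e' r' -> G (a *: e + e') (a * r + r')) ->
  (forall e r, G e r -> D e /\ `|r| <= C * Num.sqrt (dot e e)) ->
  exists2 u, D u & (forall e r, G e r -> dot u e = r) /\ dot u u <= C ^+ 2.
Proof.
move=> cD C0 G0 GP GD.
pose J (p : E * R) := dot p.1 p.1 - 2 * p.2.
have Jlb p : G p.1 p.2 -> - C ^+ 2 <= J p.
  move=> /GD[Dp rp]; rewrite /J; have s0 := sqrtr_ge0 (dot p.1 p.1).
  have := sqr_sqrtr (semi_inner_ge0 S Dp); have := ler_norm p.2.
  by have := sqr_ge0 (Num.sqrt (dot p.1 p.1) - C); lra.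
pose A := [set J p | p in [set p | G p.1 p.2]].
have A0 : A !=set0 by exists (J (0, 0)), (0, 0).
have lA : has_lbound A by exists (- C ^+ 2) => _ [p Gp <-]; exact: Jlb.
pose m := inf A.
have mJ p : G p.1 p.2 -> m <= J p by move=> Gp; apply: ge_inf => //; exists p.
have /choice[x xP] (n : nat) : exists p, G p.1 p.2 /\ J p < m + n.+1%:R^-1.
  have n0 : 0 < n.+1%:R^-1 :> R by rewrite invr_gt0.
  by have [_ [p Gp <-] Jp] := inf_adherent n0 (conj A0 lA); exists p.
have Gx n : G (x n).1 (x n).2 by case: (xP n).
have Dx n : D (x n).1 by case: (GD _ _ (Gx n)).
have small (M e : R) : 0 <= M -> 0 < e -> exists N, forall n, (N <= n)%N ->
    M * n.+1%:R^-1 < e.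
  move=> M0 e0; exists (Num.bound (M / e)) => n Nn.
  have n0 : 0 < n.+1%:R :> R by [].
  rewrite ltr_pdivrMr// -ltr_pdivrMl// mulrC.
  apply: lt_le_trans (archi_boundP _) _; first by rewrite divr_ge0// ltW.
  by rewrite ler_nat (leq_trans Nn).
have [|u Du xu] := cD (fun n => (x n).1) Dx.
  move=> e e0; have [||N NP] := small 2 (e / 2); [lra|lra|].
  exists N => n k Nn Nk.
  (* Parallelogram identity: the midpoint cannot go below the infimum. *)
  have Gm : G (2^-1 *: (x n).1 + 2^-1 *: (x k).1)
              (2^-1 * (x n).2 + 2^-1 * (x k).2).
    apply: (GP) => //; have := GP 2^-1 _ _ _ _ (Gx k) G0.
    by rewrite !addr0.
  have /= := mJ (_, _) Gm; rewrite /J/=.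
  rewrite semi_inner_sqr//; last exact: semi_inner_domZ.
  have -> : dot (2^-1 *: (x k).1) (2^-1 *: (x k).1) =
      2^-1 ^+ 2 * dot (x k).1 (x k).1.
    have D0 := semi_inner_dom0 S.
    have := semi_inner_sqr 2^-1 (Dx k) D0; rewrite !addr0 => ->.
    by rewrite (semi_innerC S (Dx k) D0) !semi_inner0l//; ring.
  have -> : dot (x n).1 (2^-1 *: (x k).1) = 2^-1 * dot (x n).1 (x k).1.
    have D0 := semi_inner_dom0 S.
    have := semi_inner_Pr 2^-1 (Dx k) D0 (Dx n); rewrite !addr0 => ->.
    by rewrite (semi_innerC S (Dx n) D0) semi_inner0l// addr0.
  have := NP _ Nn; have := NP _ Nk.
  have [_] := xP n; have [_] := xP k; rewrite /J/= semi_inner_sqrB//.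
  move: (n.+1%:R^-1) (k.+1%:R^-1) (dot _ _) (dot (x k).1 _) (dot (x n).1 _).
  by move=> *; lra.
(* First variation of [J] at [x n] in the direction [(e, r)]. *)
have ue e r : G e r -> dot u e = r.
  move=> Ger; have [De _] := GD _ _ Ger.
  have q0 := semi_inner_ge0 S De.
  have xe n : (dot (x n).1 e - r) ^+ 2 <= n.+1%:R^-1 * (dot e e + 1).
    apply: quadratic_bound => // t.
    have /= := mJ (_, _) (GP t _ _ _ _ Ger (Gx n)); rewrite /J/=.
    rewrite semi_inner_sqr// (semi_innerC S De)//.
    have [_] := xP n; rewrite /J.
    move: (n.+1%:R^-1) (dot _ e) (dot e e) (dot (x n).1 _) => i y q z.
    by lra.
  apply/eqP; rewrite -subr_eq0 -sqrf_eq0 eq_le sqr_ge0 andbT.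
  apply/ler_addgt0Pr => d d0; rewrite add0r.
  have [||N1 N1P] := small (2 * (dot e e + 1)) (d / 2); [lra|lra|].
  have [|N2 N2P] := xu (d / (4 * (dot e e + 1))).
    by rewrite divr_gt0//; lra.
  have := N1P _ (leq_maxl N1 N2); have := N2P _ (leq_maxr N1 N2).
  set n := maxn _ _; have := xe n.
  have := cauchy_schwarz_sqr (semi_inner_domB (Dx n) Du) De.
  rewrite semi_innerBl// ltr_pdivlMr; last by lra.
  set a := dot (x n).1 e; set b := dot u e; set q := dot e e.
  set z := dot _ _; set i := _^-1; move=> h1 h2 h3 h4.
  have z0 : 0 <= z by apply: (semi_inner_ge0 S); exact: semi_inner_domB.
  have : (b - r) ^+ 2 <= 2 * (a - b) ^+ 2 + 2 * (a - r) ^+ 2.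
    by have := sqr_ge0 (a - b + (a - r)); lra.
  by rewrite /q in h1 h2 h3 h4 q0 *; nra.
exists u => //; split=> //.
(* [u] is tested against [x n], whose product with [u] is now known to be the
   value [(x n).2], bounded by [C] times the norm of [x n]. *)
suff H (d : R) : 0 < d -> dot u u <= C ^+ 2 + d by exact/ler_addgt0Pr.
move=> d0; have [N NP] := xu d d0.
have := NP N (leqnn N); rewrite semi_inner_sqrB//.
have [_] := GD _ _ (Gx N); rewrite -(ue _ _ (Gx N)) (semi_innerC S (Dx N) Du).
have q0 := semi_inner_ge0 S (Dx N); have := sqr_sqrtr q0.
have := sqrtr_ge0 (dot (x N).1 (x N).1); move: q0 {NP}.
move: (dot u (x N).1) (dot (x N).1 _) (dot u u) => b q p q0.
move: (Num.sqrt q) => s s0 sE bC h.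
have bC2 : b ^+ 2 <= C ^+ 2 * q.
  by rewrite -sE -exprMn -real_normK ?num_real// lerXn2r ?nnegrE// mulr_ge0.
have [C1|C1] := ltP 0 C; last first.
  have C2 : C = 0 by lra.
  move: bC; rewrite C2 mul0r normr_le0 => /eqP b0; move: h; rewrite b0.
  by lra.
have C2 : 0 < C ^+ 2 by rewrite exprn_gt0.
have : (b - C ^+ 2) ^+ 2 <= C ^+ 2 * (d + C ^+ 2 - p) by nra.
have := sqr_ge0 (b - C ^+ 2) => h1 h2.
have : 0 <= C ^+ 2 * (d + C ^+ 2 - p) by lra.
by rewrite pmulr_rge0//; lra.
Qed.

End SemiInnerTheory.

(** * Weighted spaces of square-integrable functions *)

Section WeightedL2.
Context d (T : measurableType d) (R : realType).
Variables (mu : {measure set T -> \bar R}) (D : set T) (rho : T -> R).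
Hypotheses (mD : measurable D) (mrho : measurable_fun D rho)
  (rho0 : forall z, 0 <= rho z).
Implicit Types f g : T -> R.

Definition wL2 f : Prop := measurable_fun D f /\
  (\int[mu]_(z in D) (rho z * f z ^+ 2)%:E < +oo)%E.

Definition wdot f g : R := \int[mu]_(z in D) (rho z * f z * g z).

Lemma wL2_measurable_sqr f : measurable_fun D f ->
  measurable_fun D (fun z => rho z * f z ^+ 2).
Proof. by move=> mf; apply: measurable_funM => //; exact: measurable_funX. Qed.

Lemma wsqr_ge0 f z : 0 <= rho z * f z ^+ 2.
Proof. by rewrite mulr_ge0// sqr_ge0. Qed.

Lemma wL2_integrable_sqr f : wL2 f ->
  mu.-integrable D (EFin \o (fun z => rho z * f z ^+ 2)).
Proof.
move=> [mf foo]; apply/integrableP; split.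
  by apply/measurable_EFinP; exact: wL2_measurable_sqr.
by under eq_integral do rewrite gee0_abs ?lee_fin ?wsqr_ge0//.
Qed.

Lemma wdot_sqrE f : wL2 f ->
  (\int[mu]_(z in D) (rho z * f z ^+ 2)%:E)%E = (wdot f f)%:E.
Proof.
move=> Lf; rewrite /wdot /Rintegral fineK; last first.
  apply: integrable_fin_num => //.
  apply: eq_integrable (wL2_integrable_sqr Lf) => // z _ /=.
  by rewrite expr2 mulrA.
by apply: eq_integral => z _; rewrite expr2 mulrA.
Qed.

Lemma wL2_integrable_mul f g : wL2 f -> wL2 g ->
  mu.-integrable D (EFin \o (fun z => rho z * f z * g z)).
Proof.
move=> Lf Lg; have := integrableD mD (wL2_integrable_sqr Lf)
  (wL2_integrable_sqr Lg).
apply: le_integrable => //.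
  apply/measurable_EFinP; apply: measurable_funM; last by case: Lg.
  by apply: measurable_funM => //; case: Lf.
move=> z _ /=; rewrite lee_fin [leRHS]ger0_norm; last by rewrite addr_ge0// wsqr_ge0.
rewrite -mulrA normrM (ger0_norm (rho0 z)) -mulrDr ler_wpM2l//.
have := sqr_ge0 (f z - g z); have := sqr_ge0 (f z + g z).
by have := sqr_ge0 (f z); have := sqr_ge0 (g z); rewrite ler_norml; nra.
Qed.

Lemma wL2P (a : R) f g : wL2 f -> wL2 g -> wL2 (a *: f + g).
Proof.
move=> Lf Lg; have [mf _] := Lf; have [mg _] := Lg.
have mfg : measurable_fun D (a *: f + g).
  apply: measurable_funD => //.
  by apply: measurable_funM => //; exact: measurable_cst.
split=> //.
apply: le_lt_trans (_ : _ <= \int[mu]_(z in D) ((2 * a ^+ 2)%:E *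
    (rho z * f z ^+ 2)%:E + 2%:E * (rho z * g z ^+ 2)%:E))%E _.
  apply: ge0_le_integral => //.
  - by move=> z _; rewrite lee_fin wsqr_ge0.
  - by apply/measurable_EFinP; exact: wL2_measurable_sqr.
  - apply: emeasurable_funD; apply/measurable_EFinP;
      (apply: measurable_funM; first exact: measurable_cst);
      exact: wL2_measurable_sqr.
  - move=> z _; rewrite lee_fin.
    have -> : (a *: f + g) z = a * f z + g z by [].
    have := wsqr_ge0 (a *: f - g) z.
    have -> : (a *: f - g) z = a * f z - g z by [].
    by move: (rho z) (f z) (g z) => r x y; lra.
apply: integrable_lty => //; apply: integrableD => //; apply: integrableZl => //;
  exact: wL2_integrable_sqr.
Qed.

Lemma wL2_0 : wL2 0.
Proof.
split; first exact: measurable_cst.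
under eq_integral do rewrite expr0n mulr0.
by rewrite integral0.
Qed.

Lemma wdot_semi_inner : @semi_inner R (T -> R) wL2 wdot.
Proof.
split=> [||f g Lf Lg|a f g h Lf Lg Lh|f Lf].
- exact: wL2_0.
- exact: wL2P.
- by apply: eq_Rintegral => z _; rewrite mulrAC.
- rewrite /wdot -RintegralZl//; last exact: wL2_integrable_mul.
  rewrite -RintegralD//; last 2 first.
  + have := integrableZl mD a (wL2_integrable_mul Lf Lh).
    by apply: eq_integrable.
  + exact: wL2_integrable_mul.
  apply: eq_Rintegral => z _.
  have -> : (a *: f + g) z = a * f z + g z by [].
  by ring.
- by apply: Rintegral_ge0 => z _; rewrite -mulrA -expr2 wsqr_ge0.
Qed.

Lemma measurable_fine_limn_esup (f_ : nat -> T -> R) :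
  (forall n, measurable_fun D (f_ n)) ->
  measurable_fun D (fun z => fine (limn_esup (fun n => (f_ n z)%:E))).
Proof.
move=> mf; apply: (measurableT_comp (@fine_measurable R setT _)) => //.
apply: (@measurable_fun_limn_esup _ _ _ _ (fun n z => (f_ n z)%:E)) => n.
by apply/measurable_EFinP.
Qed.

(** If the increments of a sequence decrease geometrically in the square mean,
the series of their squares, rescaled by [4 ^ k], has a finite integral; where
it is finite the increments are dominated by a geometric sequence. *)
Lemma fast_cauchy_ae_cvg (y : nat -> T -> R) :
  (forall k, wL2 (y k)) ->
  (forall k, wdot (y k.+1 - y k) (y k.+1 - y k) <= (4 ^+ k * 2 ^+ k.+1)^-1) ->
  {ae mu, forall z, D z -> rho z != 0 -> cvgn (fun k => y k z)}.
Proof.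
move=> Ly yP; have S := wdot_semi_inner.
(* The bound on the increments makes the integral of [F k] at most
   1 / 2 ^ (k + 1). *)
pose F k z := ((4 ^+ k)%:E * (rho z * (y k.+1 - y k) z ^+ 2)%:E)%E.
have Ld k : wL2 (y k.+1 - y k) by exact: (semi_inner_domB S).
have F0 k z : (0 <= F k z)%E.
  by rewrite mule_ge0// lee_fin ?wsqr_ge0// exprn_ge0.
have md k : measurable_fun D (fun z => (rho z * (y k.+1 - y k) z ^+ 2)%:E).
  by apply/measurable_EFinP/wL2_measurable_sqr; case: (Ld k).
have mF k : measurable_fun D (F k).
  by apply: emeasurable_funM => //; exact: measurable_cst.
have mS : measurable_fun D (fun z => \sum_(0 <= k <oo) F k z)%E.
  exact: ge0_emeasurable_sum.
have iS : mu.-integrable D (fun z => \sum_(0 <= k <oo) F k z)%E.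
  apply/integrableP; split => //.
  under eq_integral do rewrite gee0_abs ?nneseries_ge0//.
  rewrite integral_nneseries//.
  apply: (@le_lt_trans _ _ 1%E); last exact: ltry.
  have e1 : (0 : R) <= 1 by [].
  have := @epsilon_trick R (fun=> 0%E) 1 predT (fun=> lexx _) e1.
  rewrite [X in (_ <= X + _)%E]eseries0// add0e; apply: le_trans.
  apply: lee_nneseries => [k _ _|k _]; first by apply: integral_ge0 => z _.
  rewrite /F ge0_integralZl//; last by move=> z _; rewrite lee_fin wsqr_ge0.
  rewrite /= add0e (wdot_sqrE (Ld k)) -EFinM lee_fin natrX.
  have h4 : 0 < (4 : R) ^+ k by rewrite exprn_gt0.
  rewrite -ler_pdivlMl//; apply: le_trans (yP k) _.
  by rewrite invfM mul1r.
apply: filterS (integrable_ae mD iS) => z /= zP Dz r0.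
have {}r0 : 0 < rho z by rewrite lt0r r0 rho0.
have {zP}/fineK := zP Dz; set M := fine _ => ME.
have FM k : 4 ^+ k * (rho z * (y k.+1 z - y k z) ^+ 2) <= M.
  rewrite -lee_fin ME.
  have := @nneseries_lim_ge R (F^~ z) predT 0 k.+1 (fun n _ _ => F0 n z).
  apply: le_trans; rewrite big_nat_recr//= leeDr//.
  by apply: sume_ge0 => i _.
have M0 : 0 <= M.
  have := FM 0%N; rewrite expr0 mul1r; apply: le_trans.
  by rewrite mulr_ge0// sqr_ge0.
pose u k := y k z.
have tE : u = (fun k => u 0%N + series (telescope u) k).
  by apply/funext => k; exact: eq_sum_telescope.
rewrite -/u tE; apply: is_cvgD; first exact: is_cvg_cst.
apply: normed_cvg.
apply: (@series_le_cvg _ _ (geometric (Num.sqrt (M / rho z)) 2^-1)).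
- by move=> n /=.
- by move=> n; apply: geometric_ge0; rewrite ?sqrtr_ge0 ?invr_ge0.
- move=> k /=; rewrite /telescope/=.
  rewrite -ler_sqr ?nnegrE ?mulr_ge0 ?sqrtr_ge0 ?exprn_ge0//.
  rewrite exprMn sqr_sqrtr ?divr_ge0// ?(ltW r0)// real_normK ?num_real//.
  rewrite exprVn -exprVn -exprM mulnC exprM.
  have -> : (2^-1 : R) ^+ 2 = 4^-1 by lra.
  rewrite exprVn mulrAC ler_pdivlMr// ler_pdivlMr ?exprn_gt0//.
  by have := FM k; rewrite /u; lra.
- apply: is_cvg_geometric_series.
  by rewrite ger0_norm ?invr_ge0// invf_lt1// ltr1n.
Qed.

(** The Riesz-Fischer theorem: a subsequence with fast decreasing increments
converges almost everywhere on the set where the weight is positive, and Fatou's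
lemma turns the Cauchy estimate into the estimate against the limit.  Where the
weight vanishes the candidate limit is arbitrary and contributes nothing. *)
Lemma wL2_complete : @semi_complete R (T -> R) wL2 wdot.
Proof.
move=> x Lx Cx; have S := wdot_semi_inner.
have e0 k : 0 < ((4 : R) ^+ k * 2 ^+ k.+1)^-1.
  by rewrite invr_gt0 mulr_gt0// exprn_gt0.
have /choice[N NP] k := Cx _ (e0 k).
pose s k := (\sum_(i < k.+1) (N i).+1)%N.
have sS k : s k.+1 = (s k + (N k.+1).+1)%N by rewrite /s big_ord_recr.
have Ns k : (N k <= s k)%N.
  by rewrite /s big_ord_recr/= (leq_trans (leqnSn _))// leq_addl.
have ks k : (k <= s k)%N.
  by elim: k => // k ih; rewrite sS addnS ltnS (leq_trans ih)// leq_addr.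
pose y k := x (s k).
have ycv : {ae mu, forall z, D z -> rho z != 0 -> cvgn (fun k => y k z)}.
  apply: fast_cauchy_ae_cvg => [k|k]; first exact: Lx.
  by apply/ltW/NP; rewrite ?Ns// sS (leq_trans (Ns k))// leq_addr.
pose h z := fine (limn_esup (fun k => (y k z)%:E)).
have mh : measurable_fun D h.
  by apply: measurable_fine_limn_esup => k; case: (Lx (s k)).
have key (e : R) n : (forall m, (n <= m)%N ->
      wdot (x n - x m) (x n - x m) <= e) ->
    (\int[mu]_(z in D) (rho z * (x n - h) z ^+ 2)%:E <= e%:E)%E.
  move=> nP; have Lxy k : wL2 (x n - y k).
    by apply: (semi_inner_domB S); exact: Lx.
  have mxy k : measurable_fun D (fun z => (rho z * (x n - y k) z ^+ 2)%:E).
    by apply/measurable_EFinP/wL2_measurable_sqr; case: (Lxy k).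
  have mxh : measurable_fun D (fun z => (rho z * (x n - h) z ^+ 2)%:E).
    apply/measurable_EFinP/wL2_measurable_sqr/measurable_funB => //.
    by case: (Lx n).
  have ml : measurable_fun D
      (fun z => limn_einf (fun k => (rho z * (x n - y k) z ^+ 2)%:E)).
    under eq_fun do rewrite limn_einf_lim.
    apply: (emeasurable_fun_cvg (fun i z => einfs
      (fun k => (rho z * (x n - y k) z ^+ 2)%:E) i)).
      by move=> i; exact: (measurable_fun_einfs mxy).
    by move=> z _; exact: is_cvg_einfs.
  have l0 z : (0 <= limn_einf (fun k => (rho z * (x n - y k) z ^+ 2)%:E))%E.
    rewrite limn_einf_lim; apply: lime_ge; first exact: is_cvg_einfs.
    near=> k; apply/ereal_infP => _ [i _ <-].
    by rewrite lee_fin wsqr_ge0.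
  apply: (@le_trans _ _ (\int[mu]_(z in D)
      limn_einf (fun k => (rho z * (x n - y k) z ^+ 2)%:E))%E).
    apply: ae_ge0_le_integral => //.
      by move=> z _; rewrite lee_fin wsqr_ge0.
    apply: filterS ycv => z zP Dz; have [r0|r0] := eqVneq (rho z) 0.
      by rewrite [X in (X%:E <= _)%E](_ : _ = 0) ?l0// r0 mul0r.
    have yz := zP Dz r0.
    have hz : h z = limn (fun k => y k z).
      have /cvg_limn_einf_sup[_] : (fun k => (y k z)%:E) @ \oo -->
          (limn (fun k => y k z))%:E by apply: cvg_EFin => //; near=> k.
      by rewrite /h => ->.
    have : (fun k => (rho z * (x n - y k) z ^+ 2)%:E) @ \oo -->
        (rho z * (x n - h) z ^+ 2)%:E.
      apply: cvg_EFin; first by near=> k.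
      apply: cvgM; first exact: cvg_cst.
      rewrite expr2; under eq_fun do rewrite expr2.
      by apply: cvgM; (apply: cvgB; first exact: cvg_cst); rewrite hz.
    by move=> /cvg_limn_einf_sup[-> _].
  apply: le_trans (fatou mu mD mxy _) _.
    by move=> k z _; rewrite lee_fin wsqr_ge0.
  rewrite limn_einf_lim; apply: lime_le; first exact: is_cvg_einfs.
  near=> k; apply: (@le_trans _ _
      (\int[mu]_(z in D) (rho z * (x n - y (maxn k n)) z ^+ 2)%:E)%E).
    apply: ge_ereal_inf; eexists; last exact: lexx.
    by exists (maxn k n) => //=; exact: leq_maxl.
  rewrite (wdot_sqrE (Lxy _)) lee_fin; apply: nP.
  by rewrite (leq_trans (leq_maxr k n)).
have Lxh n (e : R) : (forall m, (n <= m)%N ->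
    wdot (x n - x m) (x n - x m) <= e) -> wL2 (x n - h).
  move=> nP; split; last by apply: le_lt_trans (key _ _ nP) _; exact: ltry.
  by apply: measurable_funB => //; case: (Lx n).
have Lh : wL2 h.
  have [M MP] := Cx 1 ltr01; rewrite -[h](subKr (x M)).
  apply: (semi_inner_domB S) => //; apply: (Lxh _ 1) => m Mm.
  exact/ltW/MP.
exists h => // e e_gt0; have [|M MP] := Cx (e / 2); first by rewrite divr_gt0.
exists M => n Mn; have nP m : (n <= m)%N ->
    wdot (x n - x m) (x n - x m) <= e / 2.
  by move=> nm; apply/ltW/MP => //; rewrite (leq_trans Mn).
have := key _ _ nP; rewrite (wdot_sqrE (Lxh _ _ nP)) lee_fin => /le_lt_trans.
by apply; rewrite ltr_pdivrMr// ltr_pMr// ltr1n.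
Unshelve. all: by end_near.
Qed.

End WeightedL2.

Lemma wL2_bounded d (T : measurableType d) (R : realType)
    (mu : {measure set T -> \bar R}) (D : set T) (rho f : T -> R) (K M : R) :
  measurable D -> (mu D < +oo)%E -> measurable_fun D rho ->
  (forall z, D z -> 0 <= rho z <= K) -> measurable_fun D f ->
  (forall z, D z -> `|f z| <= M) -> wL2 mu D rho f.
Proof.
move=> mD Doo mrho rhoK mf fM; split => //.
have [->|/set0P[z Dz]] := eqVneq D set0; first by rewrite integral_set0 ltry.
apply: (@le_lt_trans _ _ (\int[mu]_(z in D) (cst (K * M ^+ 2)%:E z))%E).
  apply: ge0_le_integral => //.
  - by move=> w /rhoK/andP[r0 _]; rewrite lee_fin mulr_ge0// sqr_ge0.
  - by apply/measurable_EFinP; exact: wL2_measurable_sqr.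
  - move=> w Dw; have /andP[r0 rK] := rhoK w Dw; rewrite lee_fin ler_pM ?sqr_ge0//.
    have fw := fM w Dw.
    by rewrite -real_normK ?num_real// lerXn2r// nnegrE (le_trans _ fw).
rewrite integral_cst//; apply: lte_mul_pinfty => //.
have /andP[r0 rK] := rhoK z Dz.
by rewrite lee_fin mulr_ge0// ?sqr_ge0// (le_trans r0).
Qed.

Lemma wL2_mul_bounded d (T : measurableType d) (R : realType)
    (mu : {measure set T -> \bar R}) (D : set T) (rho f g : T -> R) (M : R) :
  measurable D -> measurable_fun D rho -> (forall z, 0 <= rho z) ->
  measurable_fun D g -> (forall z, D z -> `|g z| <= M) ->
  wL2 mu D rho f -> wL2 mu D rho (fun z => g z * f z).
Proof.
move=> mD mrho rho0 mg gM [mf foo].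
have mgf : measurable_fun D (fun z => g z * f z) by exact: measurable_funM.
split=> //; apply: (@le_lt_trans _ _
    (\int[mu]_(z in D) ((M ^+ 2)%:E * (rho z * f z ^+ 2)%:E))%E).
  apply: ge0_le_integral => //.
  - by move=> z _; rewrite lee_fin mulr_ge0// sqr_ge0.
  - by apply/measurable_EFinP; exact: wL2_measurable_sqr.
  - apply/measurable_EFinP/measurable_funM; first exact: measurable_cst.
    exact: wL2_measurable_sqr.
  - move=> z Dz; rewrite -EFinM lee_fin exprMn mulrCA ler_wpM2r//.
      exact: wsqr_ge0.
    rewrite -real_normK ?num_real// lerXn2r// ?nnegrE ?gM//.
    by rewrite (le_trans _ (gM z Dz)).
rewrite ge0_integralZl//.
- by apply: lte_mul_pinfty => //; rewrite lee_fin sqr_ge0.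
- by apply/measurable_EFinP; exact: wL2_measurable_sqr.
- by move=> z _; rewrite lee_fin wsqr_ge0.
- by rewrite lee_fin sqr_ge0.
Qed.

(** * Open and bounded sets of the plane *)

Section Plane.
Context {R : realType}.
Implicit Types (U : set (R * R)) (z : R * R).

Definition box (a b c e : R) : set (R * R) := `[a, b] `*` `[c, e].

Definition rat_box (q : (rat * rat) * (rat * rat)) : set (R * R) :=
  box (ratr q.1.1) (ratr q.1.2) (ratr q.2.1) (ratr q.2.2).

Lemma measurable_box (a b c e : R) : measurable (box a b c e).
Proof. by apply: measurableX; exact: measurable_itv. Qed.

(** The point is interior to the box, which matters below: the cutoff functions
attached to a box vanish on two of its sides. *)
Lemma open_rat_box U z : open U -> U z -> exists2 q, rat_box q `<=` U &
  (ratr q.1.1 < z.1 < ratr q.1.2) && (ratr q.2.1 < z.2 < ratr q.2.2).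
Proof.
move=> oU Uz; have /nbhs_ballP[e /= e0 eU] := open_nbhs_nbhs (conj oU Uz).
have near (x : R) : exists a b : rat,
    [/\ x - e < ratr a, ratr a < x, x < ratr b & ratr b < x + e].
  have [|a] := @rat_in_itvoo R (x - e) x; first by rewrite ltrBlDr ltrDl.
  rewrite in_itv/= => /andP[a1 a2].
  have [|b] := @rat_in_itvoo R x (x + e); first by rewrite ltrDl.
  by rewrite in_itv/= => /andP[b1 b2]; exists a, b.
have [a [b [a1 a2 b1 b2]]] := near z.1; have [c [k [c1 c2 k1 k2]]] := near z.2.
exists ((a, b), (c, k)); last by rewrite /= a2 b1 c2 k1.
move=> w [] /=; rewrite !in_itv/= => /andP[w1 w2] /andP[w3 w4].
apply: eU; split; rewrite /ball/= ltr_norml; lra.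
Qed.

Lemma open_bigcup_rat_box U : open U ->
  U = \bigcup_q (if `[< rat_box q `<=` U >] then rat_box q else set0).
Proof.
move=> oU; apply/seteqP; split=> [z Uz|z [q _]]; last first.
  by case: asboolP => // + qz; apply.
have [q qU /andP[q1 q2]] := open_rat_box oU Uz; exists q => //.
rewrite asboolT//; split; rewrite /= in_itv/=.
  by case/andP: q1 => /ltW -> /ltW ->.
by case/andP: q2 => /ltW -> /ltW ->.
Qed.

Lemma open_plane_measurable U : open U -> measurable U.
Proof.
move=> oU; rewrite (open_bigcup_rat_box oU).
apply: countable_bigcupT_measurable => [|q]; first exact: countableP.
by case: ifP => _; [exact: measurable_box|exact: measurable0].
Qed.

Lemma open_plane_continuous_measurable U (f : R * R -> R) : open U ->
  (forall z, U z -> {for z, continuous f}) -> measurable_fun U f.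
Proof.
move=> oU cf; apply: (measurability _ (RGenOpens.measurableE R)).
move=> _ [_ [a [b ->] <-]]; apply: open_plane_measurable.
rewrite openE => z [Uz fz].
have n1 : nbhs z U by exact: open_nbhs_nbhs.
have n2 : nbhs z (f @^-1` `]a, b[).
  by apply: (cf z Uz); apply: open_nbhs_nbhs; split => //; exact: interval_open.
by rewrite /interior; near=> w; split; near: w.
Unshelve. all: by end_near. Qed.

Lemma bounded_plane_box U : bounded_set U ->
  exists2 M : R, 0 < M & U `<=` box (- M) M (- M) M.
Proof.
move=> [M [_ MP]]; exists (`|M| + 1); first by rewrite ltr_wpDl.
move=> z Uz; have := MP (`|M| + 1) _ z Uz.
rewrite (le_lt_trans (ler_norm M)) ?ltrDl// => /(_ isT).
rewrite /Num.norm/= => h; split; rewrite /= in_itv/= -ler_norml.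
  by apply: le_trans h; rewrite le_max lexx.
by apply: le_trans h; rewrite le_max lexx orbT.
Qed.

Lemma compact_closure_plane U : bounded_set U -> compact (closure U).
Proof.
move=> /bounded_plane_box[M M0 UM].
have cM : compact (box (- M) M (- M) M).
  by apply: compact_setX; exact: segment_compact.
apply: (subclosed_compact _ cM); first exact: closed_closure.
have <- : closure (box (- M) M (- M) M) = box (- M) M (- M) M.
  apply/esym/closure_id; apply: compact_closed cM.
  exact: norm_hausdorff.
exact: closure_subset.
Qed.

Notation mu2 := (@lebesgue_measure R \x @lebesgue_measure R)%E.

Lemma bounded_plane_finite U : measurable U -> bounded_set U ->
  (mu2 U < +oo)%E.
Proof.
move=> mU /bounded_plane_box[M M0 UM].
apply: (@le_lt_trans _ _ (mu2 (box (- M) M (- M) M))).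
  by apply: le_measure => //; rewrite inE//; exact: measurable_box.
rewrite product_measure1E; [|exact: measurable_itv..].
have itvE : @lebesgue_measure R `[- M, M] = (M - - M)%:E.
  by rewrite lebesgue_measure_itv/= lte_fin gtrN.
apply: lte_mul_pinfty; [exact: measure_ge0| |].
- by rewrite [X in X \is a fin_num]itvE.
- by rewrite [X in (X < _)%E]itvE ltry.
Qed.

End Plane.

(** * Functions smooth up to the boundary *)

Section Smooth.
Context {R : realType} (Omega : set (R * R)).
Hypotheses (oO : open Omega) (bO : bounded_set Omega).
Implicit Types (u v f g : R * R -> R) (z e : R * R) (s : seq bool).

Lemma open_eq_near f g z : (forall w, Omega w -> f w = g w) -> Omega z ->
  \near z, f z = g z.
Proof.
move=> fg Oz; have : \near z, Omega z by exact: open_nbhs_nbhs.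
by apply: filterS => w /fg.
Qed.

Lemma partial_lin s (a : R) u v : smooth_closure Omega u -> smooth_closure Omega v ->
  (forall z, Omega z ->
    partial s (a *: u + v) z = (a *: partial s u + partial s v) z) /\
  forall z e, Omega z -> e = ex \/ e = ey ->
    derivable (partial s (a *: u + v)) z e.
Proof.
move=> [_ su] [_ sv].
have dlin t z e : Omega z -> e = ex \/ e = ey ->
    derivable (partial t u) z e /\ derivable (partial t v) z e.
  move=> Oz; have [/(_ z Oz)[] ? ? _] := su t.
  by have [/(_ z Oz)[] ? ? _] := sv t; case=> ->.
have ext t : (forall z, Omega z ->
      partial t (a *: u + v) z = (a *: partial t u + partial t v) z) ->
    forall z e, Omega z -> e = ex \/ e = ey ->
    derivable (partial t (a *: u + v)) z e /\
    'D_e (partial t (a *: u + v)) z =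
      (a *: 'D_e (partial t u) + 'D_e (partial t v)) z.
  move=> eqt z e Oz exy; have [d1 d2] := dlin t z e Oz exy; split.
    apply: (@near_eq_derivable _ _ _ (a *: partial t u + partial t v)).
      by apply: open_eq_near => // w /eqt.
    apply: derivableD; [exact: derivableZ d1|exact: d2].
  rewrite (near_eq_derive e (open_eq_near eqt Oz)).
  rewrite deriveD; [|exact: derivableZ d1|exact: d2].
  by rewrite (deriveZ a d1).
have eqs : forall z, Omega z ->
    partial s (a *: u + v) z = (a *: partial s u + partial s v) z.
  elim: s => [|b s IH] z Oz //=.
  by have [|_ ->] := ext s IH z (if b then ex else ey) Oz; [case: b; tauto|].
by split=> // z e Oz exy; case: (ext s eqs z e Oz exy).
Qed.

Lemma smooth_closure_lin (a : R) u v : smooth_closure Omega u ->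
  smooth_closure Omega v -> smooth_closure Omega (a *: u + v).
Proof.
move=> su sv; have := (su, sv) => -[[cu pu] [cv pv]]; split.
  move=> z; apply: cvgD; last exact: cv.
  by apply: cvgZr; exact: cu.
move=> s; have [ps ds] := partial_lin s a su sv; split.
  by move=> z Oz; split; apply: ds => //; [left|right].
have [_ [g [cg gE]]] := pu s; have [_ [h [ch hE]]] := pv s.
exists (a *: g + h); split.
  by move=> z; apply: cvgD; [apply: cvgZr; exact: cg|exact: ch].
move=> z Oz; rewrite ps//.
have -> : (a *: g + h) z = a * g z + h z by [].
by rewrite gE// hE.
Qed.

Lemma partial0 s : partial s (0 : R * R -> R) = 0.
Proof.
by elim: s => //= b s ->; apply/funext => z; rewrite derive_cst.
Qed.

Lemma smooth_vanishing0 (G : set (R * R)) : smooth_vanishing Omega G 0.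
Proof.
split=> //; split; first by move=> z; exact: cvg_cst.
move=> s; rewrite partial0; split.
  by move=> z _; split; exact: derivable_cst.
by exists 0; split => // z; exact: cvg_cst.
Qed.

Lemma smooth_vanishing_lin (G : set (R * R)) (a : R) u v :
  smooth_vanishing Omega G u -> smooth_vanishing Omega G v ->
  smooth_vanishing Omega G (a *: u + v).
Proof.
move=> [su u0] [sv v0]; split; first exact: smooth_closure_lin.
move=> z Gz; have -> : (a *: u + v) z = a * u z + v z by [].
by rewrite u0// v0// mulr0 addr0.
Qed.

Lemma smooth_partial_continuous s u z : smooth_closure Omega u -> Omega z ->
  {for z, continuous (partial s u)}.
Proof.
move=> [_ /(_ s)[_ [g [cg gE]]]] Oz.
have cgO : {within Omega, continuous g}.
  by apply: continuous_subspaceW cg; exact: subset_closure.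
have cz : {for z, continuous g}.
  by move: cgO; rewrite continuous_open_subspace// => /(_ z); apply; rewrite inE.
have {cz} : g x @[x --> z] --> partial s u z by rewrite -gE.
by apply: cvg_trans; apply: near_eq_cvg; exact: open_eq_near.
Qed.

Lemma smooth_partial_measurable s u : smooth_closure Omega u ->
  measurable_fun Omega (partial s u).
Proof.
move=> su; apply: open_plane_continuous_measurable => // z.
exact: smooth_partial_continuous.
Qed.

Lemma smooth_partial_bounded s u : smooth_closure Omega u ->
  exists2 M : R, 0 <= M & forall z, Omega z -> `|partial s u z| <= M.
Proof.
move=> [_ /(_ s)[_ [g [cg gE]]]].
have /compact_bounded[M [_ MP]] := continuous_compact cg (compact_closure_plane bO).
exists (`|M| + 1); first by rewrite addr_ge0.
move=> z Oz; rewrite -gE//; apply: MP.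
  by rewrite (le_lt_trans (ler_norm M))// ltrDl.
by exists z => //; exact: subset_closure.
Qed.

End Smooth.

(** * The weighted space of jets *)

Section ProductSpace.
Context {R : realType} {E1 E2 : lmodType R} {D1 : E1 -> Prop} {D2 : E2 -> Prop}
  {dot1 : E1 -> E1 -> R} {dot2 : E2 -> E2 -> R}.
Hypotheses (S1 : semi_inner D1 dot1) (S2 : semi_inner D2 dot2).

Let D12 (p : E1 * E2) := D1 p.1 /\ D2 p.2.
Let dot12 (p q : E1 * E2) := dot1 p.1 q.1 + dot2 p.2 q.2.

Lemma semi_inner_prod : semi_inner D12 dot12.
Proof.
split=> [|a u v [u1 u2] [v1 v2]|u v [u1 u2] [v1 v2]
    |a u v w [u1 u2] [v1 v2] [w1 w2]|u [u1 u2]].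
- by split; [exact: (semi_inner_dom0 S1)|exact: (semi_inner_dom0 S2)].
- by split; [exact: (semi_inner_domP S1)|exact: (semi_inner_domP S2)].
- by rewrite /dot12 (semi_innerC S1)// (semi_innerC S2).
- by rewrite /dot12/= (semi_innerPl S1)// (semi_innerPl S2)//; ring.
- by rewrite addr_ge0 ?(semi_inner_ge0 S1) ?(semi_inner_ge0 S2).
Qed.

Lemma semi_complete_prod : semi_complete D1 dot1 -> semi_complete D2 dot2 ->
  semi_complete D12 dot12.
Proof.
move=> C1 C2 x Dx Cx.
have [||y1 Dy1 xy1] := C1 (fun n => (x n).1).
- by move=> n; case: (Dx n).
- move=> e /Cx[N NP]; exists N => n m Nn Nm; apply: le_lt_trans (NP n m Nn Nm).
  rewrite lerDl; apply: (semi_inner_ge0 S2); apply: (semi_inner_domB S2).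
  + by case: (Dx n).
  + by case: (Dx m).
have [||y2 Dy2 xy2] := C2 (fun n => (x n).2).
- by move=> n; case: (Dx n).
- move=> e /Cx[N NP]; exists N => n m Nn Nm; apply: le_lt_trans (NP n m Nn Nm).
  rewrite lerDr; apply: (semi_inner_ge0 S1); apply: (semi_inner_domB S1).
  + by case: (Dx n).
  + by case: (Dx m).
exists (y1, y2) => // e e0; have e2 : 0 < e / 2 by rewrite divr_gt0.
have [N1 N1P] := xy1 _ e2; have [N2 N2P] := xy2 _ e2.
exists (maxn N1 N2) => n; rewrite geq_max => /andP[/N1P h1 /N2P h2].
by rewrite /dot12/= [e]splitr ltrD.
Qed.

End ProductSpace.

Section Jets.
Context {R : realType} (m1 m2 : nat) (Omega : set (R * R)).
Hypotheses (oO : open Omega) (bO : bounded_set Omega).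
Local Notation mu2 := (@lebesgue_measure R \x @lebesgue_measure R)%E.
Local Notation jet := (@jet R).
Implicit Types (u v w : jet) (phi : R * R -> R) (G : set (R * R)).

Definition weightx (z : R * R) : R := `|z.2| ^+ m1.
Definition weighty (z : R * R) : R := `|z.1| ^+ m2.

Definition jet_dom w : Prop :=
  (wL2 mu2 Omega (fun=> 1) (val0 w) /\ wL2 mu2 Omega weightx (valx w)) /\
  wL2 mu2 Omega weighty (valy w).

Definition jet_dot u v : R :=
  wdot mu2 Omega (fun=> 1) (val0 u) (val0 v) +
  wdot mu2 Omega weightx (valx u) (valx v) +
  wdot mu2 Omega weighty (valy u) (valy v).

Let mO : measurable Omega. Proof. exact: open_plane_measurable. Qed.

Lemma weightx_ge0 z : 0 <= weightx z. Proof. by rewrite exprn_ge0. Qed.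
Lemma weighty_ge0 z : 0 <= weighty z. Proof. by rewrite exprn_ge0. Qed.

Lemma measurable_weightx : measurable_fun Omega weightx.
Proof.
apply: measurable_funTS; apply: measurable_funX.
by apply: measurableT_comp => //; exact: measurable_snd.
Qed.

Lemma measurable_weighty : measurable_fun Omega weighty.
Proof.
apply: measurable_funTS; apply: measurable_funX.
by apply: measurableT_comp => //; exact: measurable_fst.
Qed.

Lemma semi_inner0 : @semi_inner R (R * R -> R) (wL2 mu2 Omega (fun=> 1))
  (wdot mu2 Omega (fun=> 1)).
Proof. exact: (wdot_semi_inner mu2 mO (measurable_cst _) (fun=> ler01)). Qed.

Lemma semi_innerx : @semi_inner R (R * R -> R) (wL2 mu2 Omega weightx)
  (wdot mu2 Omega weightx).
Proof. exact: (wdot_semi_inner mu2 mO measurable_weightx weightx_ge0). Qed.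

Lemma semi_innery : @semi_inner R (R * R -> R) (wL2 mu2 Omega weighty)
  (wdot mu2 Omega weighty).
Proof. exact: (wdot_semi_inner mu2 mO measurable_weighty weighty_ge0). Qed.

Lemma jet_semi_inner : @semi_inner R jet jet_dom jet_dot.
Proof.
exact: (semi_inner_prod (semi_inner_prod semi_inner0 semi_innerx) semi_innery).
Qed.

Lemma jet_complete : @semi_complete R jet jet_dom jet_dot.
Proof.
apply: (semi_complete_prod (semi_inner_prod semi_inner0 semi_innerx) semi_innery).
  apply: (semi_complete_prod semi_inner0 semi_innerx).
    exact: (@wL2_complete _ _ _ mu2 Omega (fun=> 1) mO (measurable_cst (1 : R))
      (fun=> ler01)).
  exact: (@wL2_complete _ _ _ mu2 Omega _ mO measurable_weightx weightx_ge0).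
exact: (@wL2_complete _ _ _ mu2 Omega _ mO measurable_weighty weighty_ge0).
Qed.

Definition jet_measurable w : Prop := [/\ measurable_fun Omega (val0 w),
  measurable_fun Omega (valx w) & measurable_fun Omega (valy w)].

Lemma jet_dom_measurable w : jet_dom w -> jet_measurable w.
Proof. by move=> [[[? _] [? _]] [? _]]. Qed.

Lemma jet_integralE w : jet_measurable w ->
  (\int[mu2]_(z in Omega)
      (`|z.2| ^+ m1 * valx w z ^+ 2 + `|z.1| ^+ m2 * valy w z ^+ 2
       + val0 w z ^+ 2)%R%:E =
   \int[mu2]_(z in Omega) (1 * val0 w z ^+ 2)%R%:E +
   \int[mu2]_(z in Omega) (weightx z * valx w z ^+ 2)%R%:E +
   \int[mu2]_(z in Omega) (weighty z * valy w z ^+ 2)%R%:E)%E.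
Proof.
move=> [m0 mx my].
have Mx : measurable_fun Omega (fun z => weightx z * valx w z ^+ 2).
  exact: (wL2_measurable_sqr measurable_weightx).
have My : measurable_fun Omega (fun z => weighty z * valy w z ^+ 2).
  exact: (wL2_measurable_sqr measurable_weighty).
have M0 : measurable_fun Omega (fun z => 1 * val0 w z ^+ 2).
  exact: (wL2_measurable_sqr (measurable_cst _)).
rewrite -ge0_integralD//; last 4 first.
- by move=> z _; rewrite lee_fin mul1r sqr_ge0.
- exact/measurable_EFinP.
- by move=> z _; rewrite lee_fin; apply: wsqr_ge0; exact: weightx_ge0.
- exact/measurable_EFinP.
rewrite -ge0_integralD//; last 4 first.
- move=> z _; rewrite -EFinD lee_fin addr_ge0// ?mul1r ?sqr_ge0//.
  by apply: wsqr_ge0; exact: weightx_ge0.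
- by apply: emeasurable_funD; exact/measurable_EFinP.
- by move=> z _; rewrite lee_fin; apply: wsqr_ge0; exact: weighty_ge0.
- exact/measurable_EFinP.
apply: eq_integral => z _; rewrite -!EFinD; congr EFin.
by rewrite /weightx /weighty; ring.
Qed.

Lemma W1normE w : jet_dom w ->
  W1norm m1 m2 Omega w = (Num.sqrt (jet_dot w w))%:E.
Proof.
move=> Dw; have [[w0 wx] wy] := Dw.
rewrite /W1norm jet_integralE; last exact: jet_dom_measurable.
rewrite (@wdot_sqrE _ _ _ mu2 Omega (fun=> 1) mO (measurable_cst _)
  (fun=> ler01) _ w0).
rewrite (@wdot_sqrE _ _ _ mu2 Omega _ mO measurable_weightx weightx_ge0 _ wx).
rewrite (@wdot_sqrE _ _ _ mu2 Omega _ mO measurable_weighty weighty_ge0 _ wy).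
by rewrite -!EFinD poweR_EFin powR12_sqrt// (semi_inner_ge0 jet_semi_inner).
Qed.

Lemma jet_domP w : jet_measurable w ->
  (W1norm m1 m2 Omega w < +oo)%E -> jet_dom w.
Proof.
move=> mw; have [m0 mx my] := mw; rewrite /W1norm jet_integralE// => foo.
have i0 : (0 <= \int[mu2]_(z in Omega) (1 * val0 w z ^+ 2)%R%:E)%E.
  by apply: integral_ge0 => z _; rewrite lee_fin mul1r sqr_ge0.
have ix : (0 <= \int[mu2]_(z in Omega) (weightx z * valx w z ^+ 2)%R%:E)%E.
  by apply: integral_ge0 => z _; rewrite lee_fin wsqr_ge0//; exact: weightx_ge0.
have iy : (0 <= \int[mu2]_(z in Omega) (weighty z * valy w z ^+ 2)%R%:E)%E.
  by apply: integral_ge0 => z _; rewrite lee_fin wsqr_ge0//; exact: weighty_ge0.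
have h0 : (2^-1 : R) != 0 by rewrite invr_eq0 pnatr_eq0.
have {}foo := lty_poweRy h0 foo.
split; first split; split=> //; apply: le_lt_trans foo.
- by rewrite -addeA leeDl// adde_ge0.
- by rewrite addeAC leeDr// adde_ge0.
- by rewrite leeDr// adde_ge0.
Qed.

End Jets.

(** * The spaces W1, the energy form and the square-integrable data *)

Section Spaces.
Context {R : realType} (m1 m2 : nat) (Omega : set (R * R)).
Hypotheses (oO : open Omega) (bO : bounded_set Omega).
Local Notation mu2 := (@lebesgue_measure R \x @lebesgue_measure R)%E.
Local Notation jet := (@jet R).
Local Notation jdom := (jet_dom m1 m2 Omega).
Local Notation jdot := (jet_dot m1 m2 Omega).
Local Notation W1 := (@W1 R m1 m2 Omega).
Local Notation W1norm := (@W1norm R m1 m2 Omega).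
Implicit Types (u v w : jet) (phi : R * R -> R) (G : set (R * R)).

Let mO : measurable Omega. Proof. exact: open_plane_measurable. Qed.
Let S := jet_semi_inner m1 m2 oO.

Lemma weightx_bounded : exists K : R, forall z, Omega z ->
  0 <= weightx m1 z <= K.
Proof.
have [M M0 OM] := bounded_plane_box bO; exists (M ^+ m1) => z /OM[_] /=.
rewrite in_itv/= -ler_norml => zM.
by rewrite weightx_ge0 lerXn2r// nnegrE (le_trans _ zM).
Qed.

Lemma weighty_bounded : exists K : R, forall z, Omega z ->
  0 <= weighty m2 z <= K.
Proof.
have [M M0 OM] := bounded_plane_box bO; exists (M ^+ m2) => z /OM[] /=.
rewrite in_itv/= -ler_norml => zM _.
by rewrite weighty_ge0 lerXn2r// nnegrE (le_trans _ zM).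
Qed.

Lemma jet_of_dom phi : smooth_closure Omega phi -> jdom (jet_of phi).
Proof.
move=> sp; have Oo := bounded_plane_finite mO bO.
have mp s := smooth_partial_measurable oO s sp.
have bp s := smooth_partial_bounded bO s sp.
have [Kx Kx1] := weightx_bounded; have [Ky Ky1] := weighty_bounded.
have [M0 _ M01] := bp [::]; have [Mx _ Mx1] := bp [:: true].
have [My _ My1] := bp [:: false].
split; first split.
- apply: (@wL2_bounded _ _ _ mu2 _ _ _ 1 M0 mO Oo _ _ (mp [::]) M01) => //.
  by move=> z _; rewrite ler01 lexx.
- exact: (@wL2_bounded _ _ _ mu2 Omega (weightx m1) (valx (jet_of phi))
    Kx Mx mO Oo (@measurable_weightx _ m1 Omega)
    Kx1 (mp [:: true]) Mx1).
- exact: (@wL2_bounded _ _ _ mu2 Omega (weighty m2) (valy (jet_of phi))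
    Ky My mO Oo (@measurable_weighty _ m2 Omega)
    Ky1 (mp [:: false]) My1).
Qed.

(** Membership in W1 as approximation in the inner product, which avoids
extended-real limits in everything that follows. *)
Lemma W1P G w : W1 G w <-> jdom w /\ forall e : R, 0 < e ->
  exists2 phi, smooth_vanishing Omega G phi &
    jdot (w - jet_of phi) (w - jet_of phi) < e.
Proof.
split=> [[m0 mx my [phi [sphi cphi]]]|[Dw wP]].
  have mw : jet_measurable Omega w by [].
  have key (e : R) : 0 < e -> exists n, jdom (w - jet_of (phi n)) /\
      jdot (w - jet_of (phi n)) (w - jet_of (phi n)) < e.
    move=> e0; have s0 : 0 < Num.sqrt e by rewrite sqrtr_gt0.
    have [+ /cvgr0Pnorm_lt/(_ _ s0)] := (fine_cvgP _ _).1 cphi.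
    move=> [N1 _ N1P] [N2 _ N2P]; exists (maxn N1 N2).
    have := N1P _ (leq_maxl N1 N2); have := N2P _ (leq_maxr N1 N2).
    set n := maxn _ _ => /= h1 h2.
    have D1 : jdom (w - jet_of (phi n)).
      apply: (jet_domP oO); last by rewrite ltey_eq h2.
      have [p0 px py] := jet_dom_measurable (jet_of_dom (sphi n).1).
      split; [exact: measurable_funB m0 p0|exact: measurable_funB mx px
        |exact: measurable_funB my py].
    split=> //; move: h1; rewrite (W1normE oO)//= ger0_norm ?sqrtr_ge0//.
    by rewrite ltr_sqrt.
  split; last by move=> e /key[n [_ nP]]; exists (phi n).
  have [n [Dn _]] := key 1 ltr01.
  rewrite -[w](subrK (jet_of (phi n))); apply: (semi_inner_domD S) => //.
  exact: jet_of_dom (sphi n).1.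
have [m0 mx my] := jet_dom_measurable Dw; split=> //.
have e0 n : (0 : R) < n.+1%:R^-1 ^+ 2 by rewrite exprn_gt0// invr_gt0.
have /choice[phi phiP] n : exists phi, smooth_vanishing Omega G phi /\
    jdot (w - jet_of phi) (w - jet_of phi) < n.+1%:R^-1 ^+ 2.
  by have [phi ? ?] := wP _ (e0 n); exists phi.
exists phi; split=> [n|]; first by case: (phiP n).
have Dn n : jdom (w - jet_of (phi n)).
  by apply: (semi_inner_domB S) => //; apply: jet_of_dom; case: (phiP n) => -[].
under eq_fun do rewrite (W1normE oO (Dn _)).
apply: cvg_EFin; first by near=> n.
apply: (@squeeze_cvgr _ _ _ _ (fun=> 0) harmonic); last exact: cvg_harmonic.
  near=> n; rewrite sqrtr_ge0/= -(ger0_norm (ltW (_ : 0 < n.+1%:R^-1))) ?invr_gt0//.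
  rewrite -sqrtr_sqr ler_sqrt ?(ltW (e0 n))//.
  by case: (phiP n) => _ /ltW.
exact: cvg_cst.
Unshelve. all: by end_near. Qed.

Lemma W1_dom G w : W1 G w -> jdom w. Proof. by move=> /W1P[]. Qed.

Lemma jet_of_W1 G phi : smooth_vanishing Omega G phi -> W1 G (jet_of phi).
Proof.
move=> sp; apply/W1P; split; first exact: jet_of_dom sp.1.
move=> e e0; exists phi => //; rewrite subrr (semi_inner0l S)//.
exact: (semi_inner_dom0 S).
Qed.

Lemma jet_dot_ext u v u' v' :
  (forall z, Omega z -> [/\ val0 u z = val0 u' z, valx u z = valx u' z &
     valy u z = valy u' z]) ->
  (forall z, Omega z -> [/\ val0 v z = val0 v' z, valx v z = valx v' z &
     valy v z = valy v' z]) -> jdot u v = jdot u' v'.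
Proof.
move=> uu vv; rewrite /jet_dot; congr (_ + _ + _); apply: eq_Rintegral => z;
  by rewrite inE => Oz; have [u0 ux uy] := uu z Oz; have [v0 vx vy] := vv z Oz;
    rewrite ?u0 ?ux ?uy ?v0 ?vx ?vy.
Qed.

Lemma jet_of_lin (a : R) phi psi z : smooth_closure Omega phi ->
  smooth_closure Omega psi -> Omega z ->
  let j := a *: jet_of phi + jet_of psi in let k := jet_of (a *: phi + psi) in
  [/\ val0 k z = val0 j z, valx k z = valx j z & valy k z = valy j z].
Proof.
move=> sp sq Oz; split=> //.
- by have [+ _] := partial_lin oO [:: true] a sp sq; apply.
- by have [+ _] := partial_lin oO [:: false] a sp sq; apply.
Qed.

Lemma W1_lin G (a : R) u v : W1 G u -> W1 G v -> W1 G (a *: u + v).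
Proof.
move=> /W1P[Du uP] /W1P[Dv vP]; apply/W1P; split; first exact: (semi_inner_domP S).
move=> e e0; have a0 : 0 < 4 * (a ^+ 2 + 1) by rewrite mulr_gt0// ltr_wpDl// sqr_ge0.
(* The squared errors enter with the factors [2 * a ^+ 2] and [2]. *)
have [|p sp pP] := uP (e / (4 * (a ^+ 2 + 1))); first by rewrite divr_gt0.
have [|q sq qP] := vP (e / 4); first by rewrite divr_gt0.
exists (a *: p + q); first exact: (smooth_vanishing_lin oO).
have Dp := jet_of_dom sp.1; have Dq := jet_of_dom sq.1.
have -> : jdot (a *: u + v - jet_of (a *: p + q)) (a *: u + v - jet_of (a *: p + q))
   = jdot (a *: (u - jet_of p) + (v - jet_of q))
       (a *: (u - jet_of p) + (v - jet_of q)).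
  have H z : Omega z -> let j := a *: u + v - jet_of (a *: p + q) in
      let k := a *: (u - jet_of p) + (v - jet_of q) in
      [/\ val0 j z = val0 k z, valx j z = valx k z & valy j z = valy k z].
    move=> Oz; have [j0 jx jy] := jet_of_lin a sp.1 sq.1 Oz.
    have E (x1 x2 y1 y2 z1 : R) : z1 = a * y1 + y2 ->
      a * x1 + x2 - z1 = a * (x1 - y1) + (x2 - y2) by move=> ->; ring.
    split; [exact: (E (val0 u z) (val0 v z) (val0 (jet_of p) z) _ _ j0)
      |exact: (E (valx u z) (valx v z) (valx (jet_of p) z) _ _ jx)
      |exact: (E (valy u z) (valy v z) (valy (jet_of p) z) _ _ jy)].
  exact: jet_dot_ext.
apply: le_lt_trans (semi_inner_sqr_le S a _ _) _; try exact: (semi_inner_domB S).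
rewrite (ltr_pdivlMr _ _ a0) in pP; move: pP qP.
have := semi_inner_ge0 S (semi_inner_domB S Du Dp).
by move: (jdot _ _) (jdot _ _) => x y; nra.
Qed.

Lemma W1_semi_inner G : @semi_inner R jet (W1 G) jdot.
Proof.
split=> [|a u v|u v /W1_dom Du /W1_dom Dv|a u v w /W1_dom Du /W1_dom Dv /W1_dom Dw
    |u /W1_dom Du].
- have -> : (0 : jet) = jet_of 0.
    by rewrite /jet_of !partial0.
  exact/jet_of_W1/smooth_vanishing0.
- exact: W1_lin.
- exact: (semi_innerC S).
- exact: (semi_innerPl S).
- exact: (semi_inner_ge0 S).
Qed.

(** W1 is closed in the complete space of jets, being a closure. *)
Lemma W1_complete G : @semi_complete R jet (W1 G) jdot.
Proof.
move=> x Wx Cx; have [|y Dy xy] := jet_complete oO _ Cx.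
  by move=> n; exact: W1_dom (Wx n).
exists y => //; apply/W1P; split=> // e e0.
have [|N NP] := xy (e / 4); first by rewrite divr_gt0.
have /W1P[Dx xP] := Wx N; have [|phi sphi phiP] := xP (e / 4).
  by rewrite divr_gt0.
exists phi => //; have Dp := jet_of_dom sphi.1.
have -> : y - jet_of phi = (-1) *: (x N - y) + (x N - jet_of phi).
  by rewrite scaleN1r opprB addrA subrK.
apply: le_lt_trans (semi_inner_sqr_le S _ _ _) _; try exact: (semi_inner_domB S).
rewrite sqrrN expr1n mulr1; have := NP N (leqnn N).
by move: phiP; move: (jdot _ _) (jdot _ _) => a b; lra.
Qed.

Definition sign_pow (m : nat) (t : R) : R := if 0 <= t then 1 else (-1) ^+ m.

Lemma sign_powE m t : t ^+ m = `|t| ^+ m * sign_pow m t.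
Proof.
rewrite /sign_pow; have [t0|t0] := leP 0 t; first by rewrite ger0_norm// mulr1.
by rewrite ltr0_norm// -exprMn mulrN1 opprK.
Qed.

Lemma sign_pow_sqr m t : sign_pow m t ^+ 2 = 1.
Proof.
by rewrite /sign_pow; case: ifP; rewrite ?expr1n// exprAC sqrrN !expr1n.
Qed.

(** The coefficients of the energy form are those of the norm up to signs.
Absorbing the signs into the jet turns the energy form into the inner product,
and since the signs have square one this does not increase the norm. *)
Definition twist u : jet :=
  ((0, fun z => sign_pow m1 z.2 * valx u z), fun z => sign_pow m2 z.1 * valy u z).

Lemma measurable_sign_pow m : measurable_fun setT (sign_pow m).
Proof.
apply: measurable_fun_ifT; [|exact: measurable_cst..].
exact: measurable_fun_ler.
Qed.

Lemma twist_dom u : jdom u -> jdom (twist u).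
Proof.
move=> [[u0 [mx xoo]] [my yoo]]; split; first split.
- exact: (semi_inner_dom0 (semi_inner0 oO)).
- split; first apply: measurable_funM => //.
    apply: measurable_funTS; apply: measurableT_comp; last exact: measurable_snd.
    exact: measurable_sign_pow.
  by under eq_integral do rewrite exprMn sign_pow_sqr mul1r.
- split; first apply: measurable_funM => //.
    apply: measurable_funTS; apply: measurableT_comp; last exact: measurable_fst.
    exact: measurable_sign_pow.
  by under eq_integral do rewrite exprMn sign_pow_sqr mul1r.
Qed.

Let twist_mul m (t a p : R) :
  a * (sign_pow m t * p) * (sign_pow m t * p) = a * p * p.
Proof.
transitivity (a * p * p * sign_pow m t ^+ 2); first by ring.
by rewrite sign_pow_sqr mulr1.
Qed.

Lemma twist_sqr u : jdom u -> jdot (twist u) (twist u) <= jdot u u.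
Proof.
move=> [[u0 _] _]; rewrite /jet_dot; apply: lerD; first apply: lerD.
- rewrite (semi_inner0l (semi_inner0 oO)); last first.
    exact: (semi_inner_dom0 (semi_inner0 oO)).
  exact: (semi_inner_ge0 (semi_inner0 oO)).
- rewrite le_eqVlt; apply/orP; left; apply/eqP/eq_Rintegral => z _ /=.
  exact: twist_mul.
- rewrite le_eqVlt; apply/orP; left; apply/eqP/eq_Rintegral => z _ /=.
  exact: twist_mul.
Qed.

Lemma energyE u v : jdom u -> jdom v ->
  energy m1 m2 Omega u v = jdot (twist u) v.
Proof.
move=> Du Dv; have [[_ tx] ty] := twist_dom Du; have [[v0 vx] vy] := Dv.
rewrite /jet_dot (semi_inner0l (semi_inner0 oO))// add0r /energy /wdot.
rewrite -RintegralD//.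
- apply: eq_Rintegral => z _.
  by rewrite (sign_powE m1) (sign_powE m2) /weightx/= /weighty !mulrA.
- exact: (@wL2_integrable_mul _ _ _ mu2 _ _ mO (@measurable_weightx _ m1 Omega)
    (weightx_ge0 m1) _ _ tx vx).
- exact: (@wL2_integrable_mul _ _ _ mu2 _ _ mO (@measurable_weighty _ m2 Omega)
    (weighty_ge0 m2) _ _ ty vy).
Qed.

Lemma energyC u v : energy m1 m2 Omega u v = energy m1 m2 Omega v u.
Proof.
by apply: eq_Rintegral => z _; rewrite mulrAC [X in _ + X]mulrAC.
Qed.

Lemma energy_Pr (a : R) u v w : jdom u -> jdom v -> jdom w ->
  energy m1 m2 Omega u (a *: v + w) =
  a * energy m1 m2 Omega u v + energy m1 m2 Omega u w.
Proof.
move=> Du Dv Dw; rewrite !energyE//; last exact: (semi_inner_domP S).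
by rewrite (semi_inner_Pr S)//; exact: twist_dom.
Qed.

Lemma energy_Pl (a : R) u v w : jdom u -> jdom v -> jdom w ->
  energy m1 m2 Omega (a *: v + w) u =
  a * energy m1 m2 Omega v u + energy m1 m2 Omega w u.
Proof. by move=> *; rewrite ![energy _ _ _ _ u]energyC energy_Pr. Qed.

Lemma energy_bounded u v : jdom u -> jdom v ->
  `|energy m1 m2 Omega u v| <= Num.sqrt (jdot u u) * Num.sqrt (jdot v v).
Proof.
move=> Du Dv; rewrite energyE//; have Dt := twist_dom Du.
apply: le_trans (cauchy_schwarz S Dt Dv) _.
by rewrite ler_wpM2r ?sqrtr_ge0// ler_sqrt ?twist_sqr// (semi_inner_ge0 S).
Qed.

Lemma L2normE (f : R * R -> R) : L2norm Omega f =
  ((\int[mu2]_(z in Omega) (1 * f z ^+ 2)%:E) `^ 2^-1)%E.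
Proof.
rewrite /L2norm unlock/= [in RHS]integral_mkcond; congr (_ `^ _)%E.
apply: eq_integral => z _; rewrite !patchE; case: ifP => _.
  by rewrite mul1r -(real_normK (num_real (f z))) -powR_mulrn.
by rewrite normr0 powR0.
Qed.

Lemma L2P (f : R * R -> R) : L2 Omega f <-> wL2 mu2 Omega (fun=> 1) f.
Proof.
have h0 : (2^-1 : R) != 0 by rewrite invr_eq0 pnatr_eq0.
split=> [|Lf].
  rewrite /L2 inE => /andP[]; rewrite inE => mf.
  have {}mf : measurable_fun Omega f by apply/(measurable_restrictT _ mO).
  rewrite inE /finite_norm/= -/(L2norm Omega f) L2normE => foo.
  by split; [|exact: lty_poweRy h0 foo].
rewrite /L2 inE; apply/andP; split; rewrite inE.
  by apply/(measurable_restrictT _ mO); case: Lf.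
rewrite /finite_norm/= -/(L2norm Omega f) L2normE poweR_lty//.
by case: Lf.
Qed.

Lemma L2norm_sqrtE (f : R * R -> R) : wL2 mu2 Omega (fun=> 1) f ->
  L2norm Omega f = (Num.sqrt (wdot mu2 Omega (fun=> 1) f f))%:E.
Proof.
move=> Lf; rewrite L2normE (@wdot_sqrE _ _ _ mu2 Omega (fun=> 1) mO
  (measurable_cst _) (fun=> ler01) _ Lf).
by rewrite poweR_EFin powR12_sqrt// (semi_inner_ge0 (semi_inner0 oO)).
Qed.

End Spaces.

(** * Closability of the gradient *)

Section SegmentIBP.
Context {R : realType}.

Definition cutoff (a b t : R) : R := (t - a) * (b - t).

(** Integration by parts for the functions [f] and [cutoff a b * g]: the cutoff
vanishes at both ends, so that there are no boundary terms. *)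
Lemma cutoff_ibp (a b : R) (f g df dg : R -> R) : a < b ->
  (forall t, a <= t <= b -> is_derive t 1 f (df t)) ->
  (forall t, a <= t <= b -> is_derive t 1 g (dg t)) ->
  (forall t, a <= t <= b -> {for t, continuous df}) ->
  (forall t, a <= t <= b -> {for t, continuous dg}) ->
  (\int[lebesgue_measure]_(t in `[a, b]) (cutoff a b t * df t * g t +
     f t * ((a + b - 2 * t) * g t + cutoff a b t * dg t))%:E = 0)%E.
Proof.
move=> ab Df Dg cdf cdg; pose F t := cutoff a b t * f t * g t.
pose h t := cutoff a b t * df t * g t +
  f t * ((a + b - 2 * t) * g t + cutoff a b t * dg t).
have Dc (t : R) : is_derive t 1 (cutoff a b) (a + b - 2 * t).
  have H : is_derive t 1 ((fun t => t - a) * (fun t => b - t))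
    ((t - a) *: (0 - 1) + (b - t) *: (1 - 0)).
    exact: is_deriveM.
  apply: is_derive_eq H _; rewrite /GRing.scale/=; ring.
have DF (t : R) : a <= t <= b -> is_derive t 1 F (h t).
  move=> tab; have df1 := Df t tab; have dg1 := Dg t tab; have dc1 := Dc t.
  have H := is_deriveM (is_deriveM dc1 df1) dg1.
  apply: is_derive_eq H _; rewrite [LHS](_ : _ = cutoff a b t * f t * dg t +
    g t * (cutoff a b t * df t + f t * (a + b - 2 * t)))//.
  by rewrite /h; ring.
have cont (k dk : R -> R) (t : R) : is_derive t 1 k (dk t) -> {for t, continuous k}.
  move=> [dk1 _]; apply: differentiable_continuous; exact/derivable1_diffP.
have cF (t : R) : a <= t <= b -> {for t, continuous F}.
  by move=> /DF; exact: cont.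
rewrite (@continuous_FTC2 _ h F a b ab).
- have -> : F b = 0 by rewrite /F /cutoff subrr mulr0 !mul0r.
  have -> : F a = 0 by rewrite /F /cutoff subrr !mul0r.
  by rewrite -EFinB subrr.
- apply: continuous_in_subspaceT => t; rewrite inE/= in_itv/= => tab.
  have cf := cont _ _ _ (Df t tab); have cg := cont _ _ _ (Dg t tab).
  have cc := cont _ (fun t => a + b - 2 * t) _ (Dc t).
  rewrite /h; apply: cvgD.
    apply: cvgM cg; apply: cvgM cc _; exact: cdf.
  apply: cvgM cf _; apply: cvgD; last by apply: cvgM cc _; exact: cdg.
  apply: cvgM cg; apply: cvgB; first exact: cvg_cst.
  by apply: cvgM; [exact: cvg_cst|exact: cvg_id].
- split.
  + move=> t; rewrite in_itv/= => /andP[/ltW ta /ltW tb].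
    by have [] := DF t; rewrite ?ta.
  + by apply: cvg_at_right_filter; apply: cF; rewrite lexx ltW.
  + by apply: cvg_at_left_filter; apply: cF; rewrite lexx ltW.
- move=> t; rewrite in_itv/= => /andP[/ltW ta /ltW tb].
  by have [|_ <-] := DF t; rewrite ?ta// derive1E.
Qed.

End SegmentIBP.

Section Slices.
Context {R : realType}.
Implicit Types (b : bool) (y t : R) (phi : R * R -> R).

(** The boolean follows the convention of [partial]: [true] stands for the first
coordinate.  Both directions are treated at once in this way. *)
Definition slice b y t : R * R := if b then (t, y) else (y, t).

Lemma slice_is_derive b phi y t :
  derivable phi (slice b y t) (if b then ex else ey) ->
  is_derive t 1 (phi \o slice b y) (partial [:: b] phi (slice b y t)).
Proof.
have E : (fun h : R => h^-1 *: (phi (h *: (if b then ex else ey) + slice b y t) -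
     phi (slice b y t))) =
   (fun h : R => h^-1 *: ((phi \o slice b y) (h *: 1 + t) -
      (phi \o slice b y) t)).
  apply/funext => h; congr (_ *: (phi _ - _)); rewrite /slice; case: b.
    transitivity (h *: (1 : R) + t, h *: (0 : R) + y) => //.
    by rewrite scaler0 add0r.
  transitivity (h *: (0 : R) + y, h *: (1 : R) + t) => //.
  by rewrite scaler0 add0r.
by move=> D; split; rewrite /partial/= /derivable /derive -?E.
Qed.

Lemma slice_continuous b y : continuous (slice b y).
Proof.
case: b => t.
  by apply: (@cvg_pair _ _ _ (nbhs t) (nbhs t) (nbhs y)); [exact: cvg_id|exact: cvg_cst].
by apply: (@cvg_pair _ _ _ (nbhs t) (nbhs y) (nbhs t)); [exact: cvg_cst|exact: cvg_id].
Qed.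

Notation mu2 := (@lebesgue_measure R \x @lebesgue_measure R)%E.

Lemma slice_integral_eq0 b (F : R * R -> \bar R) :
  mu2.-integrable setT F ->
  (forall y, \int[lebesgue_measure]_t F (slice b y t) = 0)%E ->
  (\int[mu2]_z F z = 0)%E.
Proof.
move=> iF F0; rewrite -integral12_prod_meas1// /fubini_F.
case: b F0 => F0; last by under eq_integral do rewrite F0; rewrite integral0.
by rewrite Fubini//; under eq_integral do rewrite F0; rewrite integral0.
Qed.

End Slices.

Section Closability.
Context {R : realType} (m1 m2 : nat) (Omega : set (R * R)).
Hypotheses (oO : open Omega) (bO : bounded_set Omega).
Local Notation mu2 := (@lebesgue_measure R \x @lebesgue_measure R)%E.
Local Notation jet := (@jet R).
Local Notation jdom := (jet_dom m1 m2 Omega).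
Local Notation jdot := (jet_dot m1 m2 Omega).
Local Notation W1 := (@W1 R m1 m2 Omega).
Implicit Types (w : jet) (phi psi : R * R -> R) (G : set (R * R)) (z : R * R).

Let mO : measurable Omega. Proof. exact: open_plane_measurable. Qed.
Let S := jet_semi_inner m1 m2 oO.

Definition weight (b : bool) : R * R -> R := if b then weightx m1 else weighty m2.
Definition der (b : bool) (w : jet) : R * R -> R := if b then valx w else valy w.
Definition coord (b : bool) z : R := if b then z.1 else z.2.

Lemma weight_ge0 b z : 0 <= weight b z.
Proof. by case: b; [exact: weightx_ge0|exact: weighty_ge0]. Qed.

Lemma measurable_weight b : measurable_fun Omega (weight b).
Proof. by case: b; [exact: measurable_weightx|exact: measurable_weighty]. Qed.

Lemma weight_bounded b : exists K : R, forall z, Omega z -> 0 <= weight b z <= K.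
Proof. by case: b; [exact: weightx_bounded|exact: weighty_bounded]. Qed.

Lemma weight_slice b y t : weight b (slice b y t) = weight b (slice b y 0).
Proof. by case: b. Qed.

Lemma semi_inner_weight b : @semi_inner R (R * R -> R)
  (wL2 mu2 Omega (weight b)) (wdot mu2 Omega (weight b)).
Proof. by case: b; [exact: semi_innerx|exact: semi_innery]. Qed.

Lemma jet_dom_val0 w : jdom w -> wL2 mu2 Omega (fun=> 1) (val0 w).
Proof. by move=> [[]]. Qed.

Lemma jet_dom_der b w : jdom w -> wL2 mu2 Omega (weight b) (der b w).
Proof. by move=> [[] ? ?]; case: b. Qed.

Lemma jet_dot_val0_le w : jdom w ->
  wdot mu2 Omega (fun=> 1) (val0 w) (val0 w) <= jdot w w.
Proof.
move=> [[w0 wx] wy]; rewrite /jet_dot -addrA lerDl addr_ge0//.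
  exact: (semi_inner_ge0 (semi_innerx m1 oO)).
exact: (semi_inner_ge0 (semi_innery m2 oO)).
Qed.

Lemma jet_dot_der_le b w : jdom w ->
  wdot mu2 Omega (weight b) (der b w) (der b w) <= jdot w w.
Proof.
move=> [[w0 wx] wy]; have p0 := semi_inner_ge0 (semi_inner0 oO) w0.
have px := semi_inner_ge0 (semi_innerx m1 oO) wx.
have py := semi_inner_ge0 (semi_innery m2 oO) wy.
by rewrite /jet_dot; case: b; rewrite /weight /der; lra.
Qed.

Section Box.
Variables (b : bool) (q : (rat * rat) * (rat * rat)).
Let lo : R := ratr (if b then q.1.1 else q.2.1).
Let hi : R := ratr (if b then q.1.2 else q.2.2).
Hypotheses (lohi : lo < hi) (qO : rat_box q `<=` Omega).

Definition box_cutoff : R * R -> R :=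
  (fun z => cutoff lo hi (coord b z)) \_ (rat_box q).

Let side (y : R) := ratr (if b then q.2.1 else q.1.1) <= y
   <= ratr (if b then q.2.2 else q.1.2).

Lemma rat_box_slice y t : rat_box q (slice b y t) <-> lo <= t <= hi /\ side y.
Proof.
by rewrite /rat_box /box /slice /lo /hi /side; case: b; rewrite /setX/= !in_itv/=;
  tauto.
Qed.

Lemma rat_box_coord z : rat_box q z -> lo <= coord b z <= hi.
Proof.
rewrite /rat_box /box /coord /lo /hi; case: b; rewrite /setX/= !in_itv/=; tauto.
Qed.

(** The derivative along [b] of [box_cutoff] times [partial [:: b] psi], set to
zero outside the box. *)
Definition ibp_rest psi : R * R -> R :=
  (fun z => (lo + hi - 2 * coord b z) * partial [:: b] psi z +
     cutoff lo hi (coord b z) * partial [:: b; b] psi z) \_ (rat_box q).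

Lemma measurable_coord : measurable_fun Omega (coord b).
Proof.
by rewrite /coord; case: b; apply: measurable_funTS;
  [exact: measurable_fst|exact: measurable_snd].
Qed.

Lemma measurable_box_restrict (f : R * R -> R) : measurable_fun Omega f ->
  measurable_fun Omega (f \_ (rat_box q)).
Proof.
move=> mf; apply/(measurable_restrict _ (measurable_box _ _ _ _) mO).
by apply: measurable_funS mf => //; exact: subIsetl.
Qed.

Lemma measurable_cutoff_coord :
  measurable_fun Omega (fun z => cutoff lo hi (coord b z)).
Proof.
by apply: measurable_funM; apply: measurable_funB => //;
  try exact: measurable_cst; exact: measurable_coord.
Qed.

Lemma measurable_box_cutoff : measurable_fun Omega box_cutoff.
Proof. by apply: measurable_box_restrict; exact: measurable_cutoff_coord. Qed.

Lemma box_cutoff_ge0 z : 0 <= box_cutoff z.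
Proof.
rewrite /box_cutoff patchE; case: ifP => // /set_mem/rat_box_coord/andP[h1 h2].
by rewrite mulr_ge0 ?subr_ge0.
Qed.

Lemma box_cutoff_le z : `|box_cutoff z| <= (hi - lo) ^+ 2.
Proof.
rewrite ger0_norm ?box_cutoff_ge0// /box_cutoff patchE; case: ifP.
  by move=> /set_mem/rat_box_coord/andP[h1 h2]; rewrite /cutoff; nra.
by rewrite sqr_ge0.
Qed.

Lemma ibp_rest_wL2 psi : smooth_closure Omega psi ->
  wL2 mu2 Omega (fun=> 1) (fun z => weight b z * ibp_rest psi z).
Proof.
move=> sp; have mp s := smooth_partial_measurable oO s sp.
have [M1 M10 M1P] := smooth_partial_bounded bO [:: b] sp.
have [M2 M20 M2P] := smooth_partial_bounded bO [:: b; b] sp.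
have [K KP] := weight_bounded b.
have Oo := bounded_plane_finite mO bO.
apply: (@wL2_bounded _ _ _ mu2 _ (fun=> 1) _ 1
  (K * ((hi - lo) * M1 + (hi - lo) ^+ 2 * M2)) mO Oo) => //.
- by move=> z _; rewrite ler01 lexx.
- apply: measurable_funM; first exact: measurable_weight.
  apply: measurable_box_restrict; apply: measurable_funD.
    apply: measurable_funM (mp _); apply: measurable_funB => //.
    by apply: measurable_funM => //; exact: measurable_coord.
  by apply: measurable_funM (mp _); exact: measurable_cutoff_coord.
- move=> z Oz; have /andP[k0 kK] := KP z Oz.
  have d0 : 0 <= hi - lo by rewrite subr_ge0 ltW.
  rewrite normrM ger0_norm// ler_pM// /ibp_rest patchE; case: ifP; last first.
    by rewrite normr0 addr_ge0// mulr_ge0// sqr_ge0.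
  move=> /set_mem/rat_box_coord/andP[h1 h2].
  rewrite (le_trans (ler_normD _ _))// !normrM.
  apply: lerD.
    apply: ler_pM; [exact: normr_ge0|exact: normr_ge0| |exact: M1P].
    by rewrite ler_norml; lra.
  apply: ler_pM; [by rewrite mulr_ge0|exact: normr_ge0| |exact: M2P].
  by rewrite expr2 !ger0_norm ?subr_ge0// ler_pM ?subr_ge0// lerB.
Qed.

Lemma cutoff_der_wL2 f : wL2 mu2 Omega (weight b) f ->
  wL2 mu2 Omega (weight b) (fun z => box_cutoff z * f z).
Proof.
apply: (@wL2_mul_bounded _ _ _ mu2 _ _ _ _ ((hi - lo) ^+ 2)) => //.
- exact: measurable_weight.
- exact: weight_ge0.
- exact: measurable_box_cutoff.
- by move=> z _; exact: box_cutoff_le.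
Qed.

(** Integration by parts on a box, one line at a time; the weight does not
depend on the variable of integration of the inner integral. *)
Lemma box_ibp phi psi : smooth_closure Omega phi -> smooth_closure Omega psi ->
  wdot mu2 Omega (weight b) (partial [:: b] phi)
    (fun z => box_cutoff z * partial [:: b] psi z) =
  - wdot mu2 Omega (fun=> 1) phi (fun z => weight b z * ibp_rest psi z).
Proof.
move=> sf sp; apply/eqP; rewrite -subr_eq0 opprK; apply/eqP.
have Df := jet_of_dom m1 m2 oO bO sf; have Dp := jet_of_dom m1 m2 oO bO sp.
have df : wL2 mu2 Omega (weight b) (partial [:: b] phi).
  by have := jet_dom_der b Df; case: (b).
have dp : wL2 mu2 Omega (weight b) (partial [:: b] psi).
  by have := jet_dom_der b Dp; case: (b).
have i1 := @wL2_integrable_mul _ _ _ mu2 _ _ mO (@measurable_weight b)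
  (weight_ge0 b) _ _ df (cutoff_der_wL2 dp).
have i2 := @wL2_integrable_mul _ _ _ mu2 _ (fun=> 1) mO (measurable_cst _)
  (fun=> ler01) _ _ (jet_dom_val0 Df) (ibp_rest_wL2 sp).
rewrite /wdot -RintegralD//.
have iH := @integrableD _ _ _ mu2 _ mO _ _ i1 i2.
have iT := (@integrable_mkcond _ _ _ mu2 Omega _ mO).1 iH.
rewrite /Rintegral integral_mkcond.
pose H z := (weight b z * partial [:: b] phi z *
  (box_cutoff z * partial [:: b] psi z) +
  1 * phi z * (weight b z * ibp_rest psi z))%:E.
suff H0 y : (\int[lebesgue_measure]_t (H \_ Omega) (slice b y t) = 0)%E.
  suff -> : (\int[mu2]_z (H \_ Omega) z = 0)%E by [].
  exact: slice_integral_eq0 iT H0.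
(* Off the box the integrand vanishes, so each line only sees a segment. *)
have HE t : ~ (rat_box q) (slice b y t) -> (H \_ Omega) (slice b y t) = 0%E.
  move=> nq; rewrite patchE; case: ifP => // _.
  rewrite /H /box_cutoff /ibp_rest !patchE ifF; last by apply/negP => /set_mem.
  by rewrite ifF ?mul0r ?mulr0 ?addr0//; apply/negP => /set_mem.
have [sy|sy] := boolP (side y); last first.
  apply: integral0_eq => t _; apply: HE => /rat_box_slice[_].
  exact/negP.
have Ot t : lo <= t <= hi -> Omega (slice b y t).
  by move=> tlh; apply: qO; exact/rat_box_slice.
pose c := weight b (slice b y 0).
transitivity (\int[lebesgue_measure]_(t in `[lo, hi])
  (cutoff lo hi t * (c * partial [:: b] phi (slice b y t)) *
     partial [:: b] psi (slice b y t) +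
   (c * phi (slice b y t)) * ((lo + hi - 2 * t) *
     partial [:: b] psi (slice b y t) +
     cutoff lo hi t * partial [:: b; b] psi (slice b y t)))%:E)%E.
  rewrite [RHS]integral_mkcond; apply: eq_integral => t _; rewrite [RHS]patchE.
  case: ifP => [/set_mem tI|/negP tn]; last first.
    apply: HE => /rat_box_slice[tlh _]; apply: tn; apply/mem_set.
    by rewrite /= in_itv.
  have {tI}tlh : lo <= t <= hi by move: tI; rewrite /= in_itv.
  rewrite patchE ifT; last exact/mem_set/Ot.
  have ct : coord b (slice b y t) = t by case: (b).
  have qt : slice b y t \in rat_box q by apply/mem_set/rat_box_slice.
  rewrite /H /box_cutoff /ibp_rest !patchE qt ct weight_slice -/c.
  by congr EFin; ring.
have sder f s t : smooth_closure Omega f -> lo <= t <= hi ->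
    is_derive t 1 (partial s f \o slice b y) (partial (b :: s) f (slice b y t)).
  move=> [_ /(_ s)[+ _]] tlh => /(_ _ (Ot t tlh))[d1 d2].
  by apply: slice_is_derive; case: (b) d1 d2.
have scont f s t : smooth_closure Omega f -> lo <= t <= hi ->
    {for t, continuous (partial s f \o slice b y)}.
  move=> sf' tlh; apply: continuous_comp; first exact: slice_continuous.
  exact: (smooth_partial_continuous oO sf' (Ot t tlh)).
(* The weight is the constant [c] on the line and is absorbed in [phi]. *)
apply: (@cutoff_ibp _ lo hi (c *: (phi \o slice b y))
  (partial [:: b] psi \o slice b y)
  (c *: (partial [:: b] phi \o slice b y))
  (partial [:: b; b] psi \o slice b y) lohi).
- move=> t tlh; have := sder phi [::] t sf tlh => h.
  exact: is_deriveZ.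
- by move=> t tlh; exact: sder.
- by move=> t tlh; apply: cvgZr; exact: scont.
- by move=> t tlh; exact: scont.
Qed.

End Box.
Lemma jet_der_of b phi : der b (jet_of phi) = partial [:: b] phi.
Proof. by case: b. Qed.

Lemma wdot_shift (rho f g k : R * R -> R) :
  wdot mu2 Omega rho (fun z => k z * f z) g =
  wdot mu2 Omega rho f (fun z => k z * g z).
Proof. by apply: eq_Rintegral => z _; ring. Qed.

Section NullValue.
Variables (G : set (R * R)) (w : jet).
Hypotheses (Ww : W1 G w) (w0 : wdot mu2 Omega (fun=> 1) (val0 w) (val0 w) = 0).

Lemma W1_approx b (e : R) : 0 < e -> exists psi, [/\ smooth_closure Omega psi,
  wdot mu2 Omega (fun=> 1) (val0 w - psi) (val0 w - psi) <= e &
  wdot mu2 Omega (weight b) (der b w - partial [:: b] psi)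
    (der b w - partial [:: b] psi) <= e].
Proof.
move=> e0; have [Dw /(_ e e0)[psi [sp _] psiP]] := (W1P m1 m2 oO bO G w).1 Ww.
have Dd : jdom (w - jet_of psi).
  by apply: (semi_inner_domB S) => //; exact: jet_of_dom.
exists psi; split=> //.
  by apply: le_trans (ltW psiP); exact: (jet_dot_val0_le Dd).
by apply: le_trans (ltW psiP); have := jet_dot_der_le b Dd; case: b.
Qed.

Section OneBox.
Variables (b : bool) (q : (rat * rat) * (rat * rat)).
Hypotheses (lohi : ratr (if b then q.1.1 else q.2.1) <
  ratr (if b then q.1.2 else q.2.2) :> R) (qO : rat_box q `<=` Omega).

Let Dw : jdom w. Proof. exact: (W1_dom oO bO Ww). Qed.
Let S0 := semi_inner0 oO.
Let Sb := semi_inner_weight b.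

(** The derivative of [w] is orthogonal to every cut-off smooth derivative: it
is approximated by the derivatives of smooth functions [phi] with small value,
and integration by parts expresses the product through the value of [phi]. *)
Lemma der_orthogonal psi : smooth_closure Omega psi ->
  wdot mu2 Omega (weight b) (der b w)
    (fun z => box_cutoff b q z * partial [:: b] psi z) = 0.
Proof.
move=> sp; have Lw := jet_dom_der b Dw; have Lw0 := jet_dom_val0 Dw.
have Lp : wL2 mu2 Omega (weight b) (partial [:: b] psi).
  by rewrite -jet_der_of; apply: jet_dom_der; exact: jet_of_dom.
set g := fun z => _; have Lg : wL2 mu2 Omega (weight b) g.
  exact: cutoff_der_wL2.
set k := fun z => weight b z * ibp_rest b q psi z.
have Lk : wL2 mu2 Omega (fun=> 1) k by exact: ibp_rest_wL2.
apply: (@eq0_sqr_small _ _ (2 * wdot mu2 Omega (weight b) g g +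
  2 * wdot mu2 Omega (fun=> 1) k k)) => e e0.
have [phi [sf fP dP]] := W1_approx b e0.
have Lf : wL2 mu2 Omega (weight b) (partial [:: b] phi).
  by rewrite -jet_der_of; apply: jet_dom_der; exact: jet_of_dom.
have Lf0 : wL2 mu2 Omega (fun=> 1) phi.
  by have := jet_dom_val0 (jet_of_dom m1 m2 oO bO sf).
have ibp := box_ibp lohi qO sf sp; rewrite -/g -/k in ibp.
have w0k : wdot mu2 Omega (fun=> 1) (val0 w) k = 0.
  apply/eqP; rewrite -sqrf_eq0 eq_le sqr_ge0 andbT.
  by apply: le_trans (cauchy_schwarz_sqr S0 Lw0 Lk) _; rewrite w0 mul0r.
have b1 := semi_innerBl Sb Lw Lf Lg.
have b2 := semi_innerBl S0 Lw0 Lf0 Lk.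
have c1 := cauchy_schwarz_sqr Sb (semi_inner_domB Sb Lw Lf) Lg.
have c2 := cauchy_schwarz_sqr S0 (semi_inner_domB S0 Lw0 Lf0) Lk.
have g0 := semi_inner_ge0 Sb Lg; have k0 := semi_inner_ge0 S0 Lk.
have d1 := ler_wpM2r g0 dP; have d2 := ler_wpM2r k0 fP.
have {}c1 := le_trans c1 d1; have {}c2 := le_trans c2 d2.
rewrite b1 ibp in c1; rewrite b2 w0k in c2.
rewrite opprK in c1; rewrite sub0r sqrrN in c2.
exact: sqr_split_le c1 c2.
Qed.

(** The smooth derivative in the orthogonality relation can be made to approach
the derivative of [w] itself. *)
Lemma der_cutoff_null :
  wdot mu2 Omega (weight b) (der b w) (fun z => box_cutoff b q z * der b w z) = 0.
Proof.
have Lw := jet_dom_der b Dw.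
have Lg : wL2 mu2 Omega (weight b) (fun z => box_cutoff b q z * der b w z).
  exact: cutoff_der_wL2.
apply: (@eq0_sqr_small _ _ (wdot mu2 Omega (weight b)
  (fun z => box_cutoff b q z * der b w z)
  (fun z => box_cutoff b q z * der b w z))) => e e0.
have [psi [sp _ dP]] := W1_approx b e0.
have Lp : wL2 mu2 Omega (weight b) (partial [:: b] psi).
  by rewrite -jet_der_of; apply: jet_dom_der; exact: jet_of_dom.
have Lc : wL2 mu2 Omega (weight b)
    (fun z => box_cutoff b q z * partial [:: b] psi z).
  exact: cutoff_der_wL2.
have := cauchy_schwarz_sqr Sb (semi_inner_domB Sb Lw Lp) Lg.
rewrite (semi_innerBl Sb)// -[X in _ - X]wdot_shift.
rewrite (semi_innerC Sb Lc Lw) der_orthogonal// subr0.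
move=> /le_trans; apply; apply: ler_wpM2r => //; exact: (semi_inner_ge0 Sb).
Qed.

Lemma der_cutoff_ae : {ae mu2, forall z, Omega z ->
  (weight b z * der b w z * (box_cutoff b q z * der b w z))%:E = 0%E}.
Proof.
have Lw := jet_dom_der b Dw.
have Lg : wL2 mu2 Omega (weight b) (fun z => box_cutoff b q z * der b w z).
  exact: cutoff_der_wL2.
have iH := @wL2_integrable_mul _ _ _ mu2 _ _ mO (@measurable_weight b)
  (weight_ge0 b) _ _ Lw Lg.
have mH := @measurable_int _ _ _ mu2 _ _ iH.
apply: (@ae_eq_integral_abs _ _ _ mu2 _ mO _ mH).1.
transitivity ((wdot mu2 Omega (weight b) (der b w)
  (fun z => box_cutoff b q z * der b w z))%:E); last by rewrite der_cutoff_null.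
rewrite /wdot /Rintegral fineK; last exact: (@integrable_fin_num _ _ _ mu2 _ mO _ iH).
apply: eq_integral => z _; rewrite gee0_abs// lee_fin mulrACA.
apply: mulr_ge0; last by rewrite -expr2 sqr_ge0.
by rewrite mulr_ge0 ?weight_ge0 ?box_cutoff_ge0.
Qed.

End OneBox.

(** Countably many boxes cover the domain, and every point is interior to one of
them, where the cutoff is positive. *)
Lemma der_null b : wdot mu2 Omega (weight b) (der b w) (der b w) = 0.
Proof.
have Lw := jet_dom_der b (W1_dom oO bO Ww).
have iH := @wL2_integrable_mul _ _ _ mu2 _ _ mO (@measurable_weight b)
  (weight_ge0 b) _ _ Lw Lw.
have mH := @measurable_int _ _ _ mu2 _ _ iH.
have aeF : Filter (almost_everywhere mu2) by exact: ae_filter_ringOfSetsType.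
suff H : {ae mu2, forall z, Omega z ->
    (weight b z * der b w z * der b w z)%:E = 0%E}.
  rewrite /wdot /Rintegral.
  by rewrite (@ae_eq_integral _ _ _ mu2 _ (cst 0%E) _ mO mH _ H)// integral0.
have {iH mH} H : {ae mu2, forall z, forall n, Omega z -> forall q,
    unpickle n = Some q ->
    ratr (if b then q.1.1 else q.2.1) < ratr (if b then q.1.2 else q.2.2) :> R ->
    rat_box q `<=` Omega ->
    (weight b z * der b w z * (box_cutoff b q z * der b w z))%:E = 0%E}.
  apply: ae_foralln => n; case: (unpickle n) => [q|]; last first.
    by apply: aeW => z _ q.
  have [lohi|lohi] := boolP (ratr (if b then q.1.1 else q.2.1) <
      ratr (if b then q.1.2 else q.2.2) :> R); last first.
    by apply: aeW => z _ _ [<-]; rewrite (negbTE lohi).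
  have [qO|qO] := pselect (rat_box q `<=` Omega); last first.
    by apply: aeW => z _ _ [<-] _ /qO.
  by apply: (@filterS _ _ aeF) (der_cutoff_ae lohi qO) => z zP Oz _ [<-] _ _; exact: zP.
apply: (@filterS _ _ aeF) H => z zP Oz; have [q qO /andP[q1 q2]] := open_rat_box oO Oz.
have lc : ratr (if b then q.1.1 else q.2.1) < coord b z <
  ratr (if b then q.1.2 else q.2.2) by case: (b).
have /andP[lc1 lc2] := lc.
have := zP (pickle q) Oz q (pickleK q) (lt_trans lc1 lc2) qO.
have qz : z \in rat_box q.
  apply/mem_set; split; rewrite /= in_itv/=.
    by case/andP: q1 => /ltW -> /ltW ->.
  by case/andP: q2 => /ltW -> /ltW ->.
rewrite /box_cutoff patchE qz /cutoff => -[/eqP].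
rewrite mulf_eq0 mulf_eq0 [X in _ || X]mulf_eq0 mulf_eq0.
rewrite !subr_eq0 (gt_eqF lc1) (gt_eqF lc2)/= -!orbA.
by case/or3P => /eqP ->; rewrite ?(mulr0, mul0r).
Qed.

(** The gradient is closable: a limit of smooth jets whose value vanishes almost
everywhere is a null jet, although its derivatives are separate components.
Uniqueness in the weighted norm rests on this, since the admissibility
inequalities only control the square mean of the value. *)
Lemma closable : jdot w w = 0.
Proof.
have dx : wdot mu2 Omega (weightx m1) (valx w) (valx w) = 0 := der_null true.
have dy : wdot mu2 Omega (weighty m2) (valy w) (valy w) = 0 := der_null false.
by rewrite /jet_dot w0 dx dy !addr0.
Qed.

End NullValue.

End Closability.

(** * Solvability *)

Section Solvability.
Context {R : realType} (m1 m2 : nat) (Omega : set (R * R)).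
Hypotheses (oO : open Omega) (bO : bounded_set Omega).
Local Notation mu2 := (@lebesgue_measure R \x @lebesgue_measure R)%E.
Local Notation jet := (@jet R).
Local Notation jdom := (jet_dom m1 m2 Omega).
Local Notation jdot := (jet_dot m1 m2 Omega).
Local Notation W1 := (@W1 R m1 m2 Omega).
Local Notation W1norm := (@W1norm R m1 m2 Omega).
Local Notation energy := (@energy R m1 m2 Omega).
Local Notation L2sqr := (wL2 mu2 Omega (fun=> 1)).
Local Notation L2inner := (wdot mu2 Omega (fun=> 1)).
Implicit Types (u v w : jet) (f g : R * R -> R) (G : set (R * R)).

Let S := jet_semi_inner m1 m2 oO.
Let SW G := W1_semi_inner m1 m2 oO bO G.
Let S0 := semi_inner0 oO.

Lemma L2dotE f g : L2dot Omega f g = L2inner f g.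
Proof. by apply: eq_Rintegral => z _; rewrite mul1r. Qed.

Lemma W1_L2 G w : W1 G w -> L2sqr (val0 w).
Proof. by move=> /(W1_dom oO bO)/jet_dom_val0. Qed.

(** The jet [e] represents the adjoint operator applied to [v]: its norm is the
dual norm of that functional. *)
Lemma energy_representation G G' v : W1 G' v ->
  exists2 e, W1 G e & forall u, W1 G u -> jdot e u = energy u v.
Proof.
move=> /(W1_dom oO bO) Dv.
have [||||e We [eP _]] := riesz_graph (SW G) (C := Num.sqrt (jdot v v))
    (G := fun e r => W1 G e /\ r = energy e v) (@W1_complete _ m1 m2 _ oO bO G).
- exact: sqrtr_ge0.
- split; first exact: (semi_inner_dom0 (SW G)).
  have D0 := semi_inner_dom0 S; have := energy_Pl oO 1 Dv D0 D0.
  by rewrite scale1r addr0 mul1r; lra.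
- move=> a e r e' r' [We ->] [We' ->].
  split; first exact: (semi_inner_domP (SW G)).
  by rewrite (energy_Pl oO _ Dv (W1_dom oO bO We) (W1_dom oO bO We')).
- move=> e r [We ->]; split=> //; rewrite mulrC.
  exact: (energy_bounded oO (W1_dom oO bO We) Dv).
by exists e => // u Wu; apply: eP.
Qed.

(** Existence with the a priori bound: on the representatives [e] of the test
functions [v], the functional [v |-> (f, v)] is bounded in the norm of [e]; this
is the admissibility inequality, since that norm is the dual norm of the
adjoint operator applied to [v]. *)
Lemma weak_existence G G' (L : jet -> jet -> R) (C : R) f :
  0 <= C -> L2sqr f ->
  (forall u v, W1 G u -> W1 G' v -> L v u = energy u v) ->
  (forall v, W1 G' v ->
     (L2norm Omega (val0 v) <= C%:E * W1dual_norm m1 m2 Omega G (L v))%E) ->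
  exists2 u, W1 G u & (forall v, W1 G' v -> energy u v = L2dot Omega f (val0 v)) /\
    Num.sqrt (jdot u u) <= C * Num.sqrt (L2inner f f).
Proof.
move=> C0 Lf LE adm; pose nf := Num.sqrt (L2inner f f).
have nf0 : 0 <= nf by exact: sqrtr_ge0.
pose rep e v := forall u, W1 G u -> jdot e u = energy u v.
have [||||u Wu [uP uC]] := riesz_graph (SW G) (C := C * nf)
    (G := fun e r => W1 G e /\ exists v,
       [/\ W1 G' v, rep e v & r = L2dot Omega f (val0 v)])
    (@W1_complete _ m1 m2 _ oO bO G).
- by rewrite mulr_ge0.
- split; first exact: (semi_inner_dom0 (SW G)).
  exists 0; split; first exact: (semi_inner_dom0 (SW G')).
    move=> u Wu; rewrite (semi_inner0l (SW G))//.
    have Du := W1_dom oO bO Wu; have D0 := semi_inner_dom0 S.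
    by have := energy_Pr oO 1 Du D0 D0; rewrite scale1r addr0 mul1r; lra.
  rewrite L2dotE (semi_innerC S0 Lf (semi_inner_dom0 S0)).
  by rewrite (semi_inner0l S0 Lf).
- move=> a e r e' r' [We [v [Wv ev ->]]] [We' [v' [Wv' ev' ->]]].
  split; first exact: (semi_inner_domP (SW G)).
  exists (a *: v + v'); split; first exact: (semi_inner_domP (SW G')).
    move=> u Wu; rewrite (semi_innerPl (SW G))// ev// ev'//.
    have Du := W1_dom oO bO Wu.
    by rewrite (energy_Pr oO _ Du (W1_dom oO bO Wv) (W1_dom oO bO Wv')).
  by rewrite !L2dotE -(semi_inner_Pr S0 _ (W1_L2 Wv) (W1_L2 Wv') Lf).
- move=> e r [We [v [Wv ev ->]]]; split=> //.
  have dual : (W1dual_norm m1 m2 Omega G (L v) <= (Num.sqrt (jdot e e))%:E)%E.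
    apply: ge_ereal_sup => _ [u [Wu un0] <-]; have Du := W1_dom oO bO Wu.
    move: un0; rewrite (W1normE oO Du) lee_fin/= eqe => un0.
    have u_gt0 : 0 < Num.sqrt (jdot u u) by rewrite lt0r un0 sqrtr_ge0.
    rewrite ler_pdivrMr// LE// -ev//.
    exact: (cauchy_schwarz (SW G) We Wu).
  have Lv := W1_L2 Wv.
  have : (L2norm Omega (val0 v) <= (C * Num.sqrt (jdot e e))%:E)%E.
    by apply: le_trans (adm v Wv) _; rewrite EFinM lee_wpmul2l.
  rewrite L2norm_sqrtE// lee_fin => vC; rewrite L2dotE.
  apply: le_trans (cauchy_schwarz S0 Lf Lv) _.
  by rewrite mulrAC mulrC ler_wpM2r.
exists u => //; split.
  move=> v Wv; have [e We ev] := energy_representation G Wv.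
  rewrite -ev// (semi_innerC (SW G))//; apply: uP; split=> //.
  by exists v.
by rewrite -[leRHS]ger0_norm ?mulr_ge0// -sqrtr_sqr ler_sqrt// sqr_ge0.
Qed.

(** A solution with zero data is annihilated by the operator, hence has zero
value by admissibility, hence is a null jet by closability. *)
Lemma weak_uniqueness G G' (L : jet -> jet -> R) (C : R) w :
  0 <= C -> (forall u v, W1 G u -> W1 G' v -> L u v = energy u v) ->
  (forall u, W1 G u ->
     (L2norm Omega (val0 u) <= C%:E * W1dual_norm m1 m2 Omega G' (L u))%E) ->
  W1 G w ->
  (forall phi, smooth_vanishing Omega G' phi -> energy w (jet_of phi) = 0) ->
  jdot w w = 0.
Proof.
move=> C0 LE adm Ww w0; have Dw := W1_dom oO bO Ww.
have {}w0 v : W1 G' v -> energy w v = 0.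
  move=> /(W1P m1 m2 oO bO)[Dv vP]; apply: (@eq0_sqr_small _ _ (jdot w w)) => e e0.
  have [phi sphi phiP] := vP e e0; have Dp := jet_of_dom m1 m2 oO bO sphi.1.
  have Dvp := semi_inner_domB S Dv Dp.
  have -> : energy w v = energy w (v - jet_of phi).
    have := energy_Pr oO 1 Dw Dvp Dp.
    by rewrite scale1r subrK w0// mul1r addr0.
  have Dt := twist_dom oO Dw; rewrite (energyE oO Dw Dvp).
  apply: le_trans (cauchy_schwarz_sqr S Dt Dvp) _; rewrite mulrC.
  exact: ler_pM (semi_inner_ge0 S Dvp) (semi_inner_ge0 S Dt) (ltW phiP)
    (twist_sqr oO Dw).
apply: (closable oO bO Ww).
have : (L2norm Omega (val0 w) <= 0)%E.
  apply: le_trans (adm w Ww) _; rewrite -(mule0 C%:E) lee_wpmul2l//.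
  apply: ge_ereal_sup => _ [v [Wv _] <-].
  by rewrite LE// w0// normr0 mul0r.
have Lw := W1_L2 Ww; rewrite L2norm_sqrtE// lee_fin => h.
have := sqr_sqrtr (semi_inner_ge0 S0 Lw).
have -> : Num.sqrt (L2inner (val0 w) (val0 w)) = 0.
  by apply/eqP; rewrite eq_le h sqrtr_ge0.
by rewrite expr0n => <-.
Qed.

End Solvability.

Theorem theorem3 (R : realType) (m1 m2 : nat) (x0 x1 : R)
    (sigma Omega : set (R * R)) (OAC OBC : @jet R -> @jet R -> R)
    (m1_odd : odd m1) (m2_even : ~~ odd m2) (half_m2_even : ~~ odd m2./2)
    (x0_gt0 : 0 < x0) (x0_lt_x1 : x0 < x1)
    (Omega_tricomi : tricomi_domain m1 m2 x0 x1 sigma Omega)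
    (O_ext : extensions m1 m2 x0 x1 sigma Omega OAC OBC)
    (O_adm : admissible m1 m2 x0 x1 sigma Omega OAC OBC) :
  (forall f : R * R -> R, L2 Omega f ->
     exists u : @jet R, weak_solution m1 m2 x0 x1 sigma Omega f u /\
       forall u' : @jet R, weak_solution m1 m2 x0 x1 sigma Omega f u' ->
         W1eq m1 m2 Omega u' u) /\
  (forall S : (R * R -> R) -> @jet R,
     (forall f, L2 Omega f ->
        weak_solution m1 m2 x0 x1 sigma Omega f (S f)) ->
     (forall (a : R) (f g : R * R -> R), L2 Omega f -> L2 Omega g ->
        W1eq m1 m2 Omega (S (a *: f + g)) (a *: S f + S g)) /\
     seminorm_continuous (L2 Omega) (L2norm Omega) (W1norm m1 m2 Omega) S).
Proof.
have oO := tricomi_open Omega_tricomi; have bO := tricomi_bounded Omega_tricomi.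
have [_ _ adj] := O_ext; have [C3 [C4 [C3_gt0 C4_gt0 admA admB]]] := O_adm.
pose GA := gamma_AC m1 m2 x0 x1 sigma; pose GB := gamma_BC m1 m2 x0 x1 sigma.
have SA := W1_semi_inner m1 m2 oO bO GA; have S0 := semi_inner0 oO.
have toL2 f := L2P oO f.
pose jdot := jet_dot m1 m2 Omega.
pose L2inner := wdot (@lebesgue_measure R \x @lebesgue_measure R)%E Omega (fun=> 1).
pose weak f u := weak_solution m1 m2 x0 x1 sigma Omega f u.
have weak_lin (a : R) f g u v : L2 Omega f -> L2 Omega g ->
    weak f u -> weak g v -> weak (a *: f + g) (a *: u + v).
  move=> /toL2 Lf /toL2 Lg [Wu uP] [Wv vP].
  split; first exact: (semi_inner_domP SA a Wu Wv).
  move=> phi sphi; have Wp := jet_of_W1 m1 m2 oO bO sphi.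
  have Dp := W1_dom oO bO Wp; have Lp := W1_L2 oO bO Wp.
  rewrite (energy_Pl oO)//; [|exact: (W1_dom oO bO Wu)|exact: (W1_dom oO bO Wv)].
  by rewrite uP// vP// !L2dotE (semi_innerPl S0).
have L2_lin (a : R) f g : L2 Omega f -> L2 Omega g -> L2 Omega (a *: f + g).
  by move=> /toL2 Lf /toL2 Lg; apply/toL2; exact: (semi_inner_domP S0).
have weak_null u v f : L2 Omega f -> weak f u -> weak f v -> jdot (u - v) (u - v) = 0.
  move=> Lf wu wv; have [Wuv uvP] := weak_lin (-1) f f v u Lf Lf wv wu.
  rewrite scaleN1r addrC in Wuv uvP.
  apply: (weak_uniqueness oO bO (ltW C3_gt0) _ admA Wuv).
    by move=> w z Ww Wz; case: (adj w z Ww Wz).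
  move=> phi sphi; rewrite uvP// L2dotE.
  have Lp := W1_L2 oO bO (jet_of_W1 m1 m2 oO bO sphi).
  by rewrite scaleN1r addNr (semi_inner0l S0).
have weak_uniq u v f : L2 Omega f -> weak f u -> weak f v -> W1eq m1 m2 Omega u v.
  move=> Lf wu wv; have [Wu _] := wu; have [Wv _] := wv.
  rewrite /W1eq (W1normE oO).
    by rewrite -/jdot (weak_null u v f)// sqrtr0.
  exact: (W1_dom oO bO (semi_inner_domB SA Wu Wv)).
have weak_ex f : L2 Omega f -> exists2 u, weak f u &
    Num.sqrt (jdot u u) <= C4 * Num.sqrt (L2inner f f).
  move=> /toL2 Lf.
  have [|u Wu [uP uC]] := weak_existence oO bO (ltW C4_gt0) Lf _ admB.
    by move=> w z Ww Wz; case: (adj w z Ww Wz).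
  exists u => //; split=> // phi sphi.
  exact: uP (jet_of_W1 m1 m2 oO bO sphi).
split=> [f Lf|S SP].
  have [u wu _] := weak_ex f Lf; exists u; split=> // u' wu'.
  exact: weak_uniq wu' wu.
split=> [a f g Lf Lg|f Lf e e0].
  apply: (weak_uniq _ _ (a *: f + g)); first exact: L2_lin.
    by apply: SP; exact: L2_lin.
  by apply: weak_lin => //; exact: SP.
exists (e / C4) => [|g Lg]; first by rewrite divr_gt0.
have Lgf : L2 Omega (g - f) by rewrite addrC -scaleN1r; exact: L2_lin.
rewrite (L2norm_sqrtE oO); last exact/toL2.
rewrite lte_fin ltr_pdivlMr// => gf_small.
have wgf : weak (g - f) (S g - S f).
  have := weak_lin (-1) f g (S f) (S g) Lf Lg (SP f Lf) (SP g Lg).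
  by rewrite !scaleN1r [- f + g]addrC [- S f + S g]addrC.
have [u wu uC] := weak_ex _ Lgf.
have [Ww _] := wgf; have [Wu _] := wu.
rewrite (W1normE oO); last exact: (W1_dom oO bO Ww).
rewrite lte_fin; apply: le_lt_trans gf_small; rewrite mulrC; apply: le_trans uC.
have := semi_inner_minkowski SA Wu (semi_inner_domB SA Ww Wu).
by rewrite addrC subrK -/jdot (weak_null _ _ _ Lgf wgf wu) sqrtr0 addr0.
Qed.
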